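(* Let $\mathcal{G}$ be a directed acyclic graph (DAG) on the node set $[n]$. Then the DAG gaussoid of $\mathcal{G}$ is submodular. Equivalently, the associated coarsening of the $S_n$ fan is the (outer) normal fan of a polytope. Moreover, this polytope can be realized as a Minkowski sum of matroid polytopes; that is, there is a Minkowski sum of matroid polytopes of matroids on $[n]$ whose outer normal fan is the coarsening of the $S_n$ fan associated to the DAG gaussoid of $\mathcal{G}$.
   Context: Notation: $[n]=\{1,\dots,n\}$; concatenation denotes union of subsets and elements, e.g. $Lij=L\cup\{i,j\}$. DAG gaussoid. A path in $\mathcal{G}$ is an alternating sequence of nodes and edges, starting and ending at nodes, in which each edge is adjacent in the sequence to its two endpoints; nodes and edges may be repeated and edges may be traversed in either direction. For distinct $i,j\in[n]$ and $K\subseteq[n]\setminus\{i,j\}$, a Bayes ball path from $i$ to $j$ given $K$ is a path from $i$ to $j$ such that (1) if $a\to b\to c$, $a\leftarrow b\to c$ or $a\leftarrow b\leftarrow c$ occurs consecutively on the path, then $b\notin K$; (2) if $a\to b\leftarrow c$ occurs consecutively on the path ($a=c$ allowed), then $b\in K$. The nodes $i,j$ are d-separated by $K$ if there is no Bayes ball path from $i$ to $j$ given $K$. The DAG gaussoid of $\mathcal{G}$ is the set of all formal conditional independence (CI) relations $i\perp\!\!\!\perp j\mid K$ ($i,j\in[n]$ distinct, $K\subseteq[n]\setminus\{i,j\}$) such that $i$ and $j$ are d-separated by $K$ in $\mathcal{G}$. Semigraphoids. A semigraphoid on $[n]$ is a set of CI relations $i\perp\!\!\!\perp j\mid K$ such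 that: (SG1) $i\perp\!\!\!\perp j\mid L$ implies $j\perp\!\!\!\perp i\mid L$; (SG2) $i\perp\!\!\!\perp j\mid L$ and $i\perp\!\!\!\perp k\mid jL$ imply $i\perp\!\!\!\perp k\mid L$ and $i\perp\!\!\!\perp j\mid kL$ (for distinct $i,j,k$ and $L\subseteq[n]\setminus\{i,j,k\}$). DAG gaussoids are semigraphoids. Submodularity. A function $\omega:2^{[n]}\to\mathbb{R}$ is submodular if $\omega(Ki)+\omega(Kj)\ge\omega(Kij)+\omega(K)$ for all $K\subseteq[n]$ and $i,j\in[n]\setminus K$. A semigraphoid is submodular if there is a submodular function $\omega$ with $\omega(\emptyset)=0$ such that, for all distinct $i,j$ and $K\subseteq[n]\setminus\{i,j\}$, $\omega(Ki)+\omega(Kj)=\omega(Kij)+\omega(K)$ if and only if $i\perp\!\!\!\perp j\mid K$ is in the semigraphoid. $S_n$ fan and coarsenings. The $S_n$ fan in $\mathbb{R}^n$ has as maximal cones the $n!$ cones $C_\pi=\{u\in\mathbb{R}^n: u_{\pi(1)}\ge u_{\pi(2)}\ge\dots\ge u_{\pi(n)}\}$ for permutations $\pi=(\pi(1)|\cdots|\pi(n))$ of $[n]$. A CI relation $i\perp\!\!\!\perp j\mid K$ corresponds to all walls (codimension-one cones) shared by the maximal cones of $(a_1|\cdots|a_k|i|j|b_1|\cdots|b_{n-k-2})$ and $(a_1|\cdots|a_k|j|i|b_1|\cdots|b_{n-k-2})$ where $\{a_1,\dots,a_k\}=K$ and $\{b_1,\dots,b_{n-k-2}\}=[n]\setminus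 Kij$. For a semigraphoid, removing from the $S_n$ fan all walls corresponding to its CI relations gives a complete fan (a known fact), whose maximal cones are the unions of the cones $C_\pi$ over the classes of permutations connected through removed walls; this is the coarsening of the $S_n$ fan associated to the semigraphoid. The outer normal fan of a polytope $P\subset\mathbb{R}^n$ consists of the cones $N_F$ of linear functionals whose maximum over $P$ is attained on (at least) the face $F$, for $F$ ranging over the faces of $P$; $(\mathbb{R}^n)^*$ is identified with $\mathbb{R}^n$ by the dot product. The matroid polytope of a matroid on $[n]$ is the convex hull in $\mathbb{R}^n$ of the indicator vectors of its bases. *)

(* Defs.v *)
From mathcomp Require Import all_boot all_order all_algebra.
From mathcomp Require Import perm.
From mathcomp Require Import boolp classical_sets cardinality reals convex.
Set Implicit Arguments.
Unset Strict Implicit.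
Unset Printing Implicit Defensive.
Import Order.TTheory GRing.Theory Num.Theory.
Local Open Scope classical_set_scope.
Local Open Scope ring_scope.

(* A digraph on [n] is a relation [G : rel 'I_n], where [G a b] is the edge
   a -> b. *)
Definition acyclic n (G : rel 'I_n) : Prop :=
  forall c : seq 'I_n, path.cycle G c -> c = [::].

Definition adjacent n (G : rel 'I_n) : rel 'I_n := [rel a b | G a b || G b a].

(* In an acyclic digraph two adjacent nodes are joined by exactly one edge, so
   a path is determined by its sequence of nodes, here [i :: p]. *)
Definition bayes_ball_path n (G : rel 'I_n) (i j : 'I_n) (K : {set 'I_n})
    (p : seq 'I_n) : Prop :=
  [/\ path (adjacent G) i p, last i p = j &
      forall a b c : 'I_n, infix [:: a; b; c] (i :: p) ->
        ([|| G a b && G b c, G b a && G b c | G b a && G c b] -> b \notin K)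
        /\ (G a b && G c b -> b \in K)].

Definition d_separated n (G : rel 'I_n) (i j : 'I_n) (K : {set 'I_n}) : Prop :=
  ~ exists p : seq 'I_n, bayes_ball_path G i j K p.

(* [A i j K] means that the CI relation i _||_ j | K belongs to [A]; only the
   triples satisfying [ci_wf] are CI relations. *)
Definition ci_set n := 'I_n -> 'I_n -> {set 'I_n} -> Prop.

Definition ci_wf n (i j : 'I_n) (K : {set 'I_n}) : Prop :=
  [/\ i != j, i \notin K & j \notin K].

Definition dag_gaussoid n (G : rel 'I_n) : ci_set n :=
  fun i j K => ci_wf i j K /\ d_separated G i j K.

Record semigraphoid n (A : ci_set n) : Prop := {
  semigraphoid_wf : forall i j K, A i j K -> ci_wf i j K ;
  semigraphoid_sg1 : forall i j L, A i j L -> A j i L ;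
  semigraphoid_sg2 : forall (i j k : 'I_n) (L : {set 'I_n}),
    uniq [:: i; j; k] -> i \notin L -> j \notin L -> k \notin L ->
    A i j L -> A i k (j |: L) -> A i k L /\ A i j (k |: L) }.

(* The case i = j is not excluded, so these functions are also nondecreasing.
   Adding the modular function S |-> c #|S| for c large shows that this has no
   effect on the notion of submodular semigraphoid. *)
Definition submodular (R : realType) n (w : {set 'I_n} -> R) : Prop :=
  forall (K : {set 'I_n}) (i j : 'I_n), i \notin K -> j \notin K ->
    w (i |: (j |: K)) + w K <= w (i |: K) + w (j |: K).

Definition submodular_semigraphoid (R : realType) n (A : ci_set n) : Prop :=
  semigraphoid A /\
  exists w : {set 'I_n} -> R,
    [/\ submodular w, w finset.set0 = 0 &
        forall (i j : 'I_n) (K : {set 'I_n}), ci_wf i j K ->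
          (w (i |: K) + w (j |: K) = w (i |: (j |: K)) + w K <-> A i j K)].

Section Geometry.
Variables (R : realType) (n : nat).
Implicit Types (P C F : set 'rV[R]_n) (u w x y : 'rV[R]_n) (A : ci_set n).

Definition dot u x : R := \sum_(i < n) u 0 i * x 0 i.

Definition argmax w P : set 'rV[R]_n :=
  [set x | P x /\ forall y, P y -> dot w y <= dot w x].

(* Used for polytopes and for polyhedral cones; the cone itself and, for
   polytopes, the whole polytope are obtained for w = 0. *)
Definition faces P : set (set 'rV[R]_n) :=
  [set F | F !=set0 /\ exists w, F = argmax w P].

Definition normal_cone P F : set 'rV[R]_n := [set w | F `<=` argmax w P].

Definition normal_fan P : set (set 'rV[R]_n) :=
  [set normal_cone P F | F in faces P].

Definition convex_hull (V : set 'rV[R]_n) : set 'rV[R]_n :=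
  smallest (@convex_set R 'rV[R]_n) V.

Definition polytope P : Prop :=
  exists2 V : set 'rV[R]_n, finite_set V & P = convex_hull V.

Definition minkowski_sum P C : set 'rV[R]_n :=
  [set x : 'rV[R]_n | exists y z : 'rV[R]_n, [/\ P y, C z & x = y + z]].

(* The permutation (s(1)|...|s(n)); positions are numbered from 0. *)
Definition perm_cone (s : 'S_n) : set 'rV[R]_n :=
  [set u : 'rV[R]_n | forall k l : 'I_n, (k <= l)%N -> u 0 (s l) <= u 0 (s k)].

(* [s] and [t] differ by swapping the adjacent positions k, k + 1, and the
   wall between their cones corresponds to a CI relation of [A]. For a
   semigraphoid this is a symmetric relation by SG1. *)
Definition removed_wall A (s t : 'S_n) : Prop :=
  exists k l : 'I_n, [/\ l = k.+1 :> nat, t =1 s \o tperm k l &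
    A (s k) (s l) [set s m | m : 'I_n & (m < k)%N]%SET].

Definition coarse_cone A (s : 'S_n) : set 'rV[R]_n :=
  let step : rel 'S_n := fun a b => `[< removed_wall A a b >] in
  \bigcup_(t in [set t : 'S_n | connect step s t]) perm_cone t.

(* A fan is the set of all of its cones, which for a complete fan are the
   faces of its maximal cones. *)
Definition coarsening A : set (set 'rV[R]_n) :=
  [set F | exists s : 'S_n, faces (coarse_cone A s) F].

End Geometry.

Record matroid n := Matroid {
  bases : {set {set 'I_n}} ;
  bases_nonempty : bases != finset.set0 ;
  bases_exchange : forall (B1 B2 : {set 'I_n}) (x : 'I_n),
    B1 \in bases -> B2 \in bases -> x \in B1 :\: B2 ->
    exists2 y, y \in B2 :\: B1 & y |: (B1 :\ x) \in bases }.

Definition indicator (R : realType) n (B : {set 'I_n}) : 'rV[R]_n :=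
  \row_(i < n) (i \in B)%:R.

Definition matroid_polytope (R : realType) n (M : matroid n) : set 'rV[R]_n :=
  convex_hull [set indicator R B | B in [set B : {set 'I_n} | B \in bases M]].

Definition sum_matroid_polytopes (R : realType) n (Ms : seq (matroid n)) :
    set 'rV[R]_n :=
  \big[@minkowski_sum R n/[set 0]]_(M <- Ms) matroid_polytope M.

(* Main.v *)
(* The matroids are linear over F_2. A set [S] of free nodes and a subgraph [E]
   of [G] define the space of solutions of the equations "x_v is the sum of the
   x_p over the parents p of v in [E]", for v outside [S]; its coordinate
   functions form a linear matroid, in which i and j are independent given K
   unless, on the solutions vanishing on K, x_i and x_j are nonzero and
   proportional. The polytope is the Minkowski sum over all [S] and [E] of the
   matroid polytopes, and [w] is the sum of the rank functions.

   If K d-separates i and j, every solution vanishing on K can be changed to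
   one with the same x_i and with x_j = 0, by keeping its values at the nodes
   that a Bayes ball started at i can leave upwards and propagating zeros
   elsewhere. So the relations of the DAG gaussoid hold in all these matroids.
   Conversely, following a shortest Bayes ball walk from i to j, one builds
   [S] and [E] for which x_i = x_j on all solutions vanishing on K.

   The greedy vertex of a permutation s maximizes every functional of the cone
   of s. Swapping two adjacent entries does not change this vertex exactly when
   the CI relation of the wall holds, so a bubble sort shows that the coarse
   cone of s is the normal cone of its greedy vertex. It remains to see that
   the faces of these maximal cones are the normal cones of all faces, which is
   a perturbation argument in the relative interior of a face. *)

Require Import Defs.
From mathcomp Require Import boolp classical_sets cardinality reals convex.
From mathcomp Require Import interval_inference.
From mathcomp Require Import all_boot all_order all_algebra.
From mathcomp Require Import perm zify ring lra.
Set Implicit Arguments.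
Unset Strict Implicit.
Unset Printing Implicit Defensive.
Import Order.TTheory GRing.Theory Num.Theory.
Local Open Scope ring_scope.

(** * Rank functions and matroids *)

Record rank_function n (r : {set 'I_n} -> nat) : Prop := {
  rank0 : r set0 = 0%N ;
  rankS : forall A v, (r A <= r (v |: A) <= (r A).+1)%N ;
  rank_submod : forall A B : {set 'I_n},
    (r (A :|: B) + r (A :&: B) <= r A + r B)%N }.

Section RankFunction.
Variables (n : nat) (r : {set 'I_n} -> nat) (rP : rank_function r).
Implicit Types (A B C K : {set 'I_n}) (i j v : 'I_n).

(** Diminishing returns: this is submodularity for [v |: A] and [B], except that monotonicity is
    what counts when [v] already lies in [B]. *)
Lemma rank_submod1 A B v : A \subset B ->
  (r (v |: B) + r A <= r (v |: A) + r B)%N.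
Proof.
move=> sAB; have := rank_submod rP (v |: A) B.
have -> : v |: A :|: B = v |: B by rewrite -setUA (setUidPr sAB).
rewrite setIUl (setIidPl sAB).
case: (boolP (v \in B)) => vB.
  by rewrite (setUidPr _) ?sub1set // => _; rewrite addnC leq_add2r;
    case/andP: (rankS rP A v).
by rewrite (_ : [set v] :&: B = set0) ?set0U //; apply/disjoint_setI0; rewrite disjoints1.
Qed.

(** The elements of [C] are added one at a time; by diminishing returns, none of them gains rank
    from the earlier ones being present. *)
Lemma rankU_eq A C : {in C, forall v, r (v |: A) = r A} -> r (A :|: C) = r A.
Proof.
move: {2}#|C| (leqnn #|C|) => m; elim: m C => [|m IH] C.
  by rewrite leqn0 cards_eq0 => /eqP-> _; rewrite setU0.
move=> Cm hC; have [->|[v vC]] := set_0Vmem C; first by rewrite setU0.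
have IHv : r (A :|: C :\ v) = r A.
  apply: IH => [|w /setD1P[_ /hC]//].
  by move: Cm; rewrite (cardsD1 v C) vC.
have <- : v |: (A :|: C :\ v) = A :|: C by rewrite setUCA setD1K.
have := rank_submod1 v (subsetUl A (C :\ v)).
rewrite IHv (hC v vC) addnC leq_add2l => le1; apply/eqP.
rewrite eqn_leq le1 -[X in (X <= _)%N]IHv.
by case/andP: (rankS rP (A :|: C :\ v) v).
Qed.

Lemma rank_le A B : A \subset B -> (r A <= r B)%N.
Proof.
move=> /setUidPr <-.
move: {2}#|B| (leqnn #|B|) => m; elim: m B => [|m IH] B.
  by rewrite leqn0 cards_eq0 => /eqP->; rewrite setU0.
move=> Bm; have [->|[v vB]] := set_0Vmem B; first by rewrite setU0.
rewrite -(setD1K vB) setUCA; apply: leq_trans (_ : r (A :|: B :\ v) <= _)%N.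
  by apply: IH; move: Bm; rewrite (cardsD1 v B) vB.
by case/andP: (rankS rP (A :|: B :\ v) v).
Qed.

Lemma rank_card A : (r A <= #|A|)%N.
Proof.
move: {2}#|A| (leqnn #|A|) => m; elim: m A => [|m IH] A.
  by rewrite leqn0 cards_eq0 => /eqP->; rewrite (rank0 rP).
move=> Am; have [->|[v vA]] := set_0Vmem A; first by rewrite (rank0 rP).
rewrite -{1}(setD1K vA) (cardsD1 v A) vA add1n.
have /andP[_ /leq_trans] := rankS rP (A :\ v) v; apply; rewrite ltnS.
by apply: IH; move: Am; rewrite (cardsD1 v A) vA.
Qed.

Definition rank_bases : {set {set 'I_n}} :=
  [set B : {set 'I_n} | (r B == #|B|) && (r B == r [set: 'I_n])].

(** If no [w] worked, all of [B2] would lie in the closure of [B1 :\ v], which would then have full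
    rank although its rank is [#|B1| - 1]. *)
Lemma rank_bases_exchange (B1 B2 : {set 'I_n}) (v : 'I_n) :
  B1 \in rank_bases -> B2 \in rank_bases -> v \in B1 :\: B2 ->
  exists2 w, w \in B2 :\: B1 & w |: (B1 :\ v) \in rank_bases.
Proof.
rewrite !inE => /andP[/eqP c1 /eqP r1] /andP[/eqP c2 /eqP r2] /andP[vB2 vB1].
have cD : #|B1| = #|B1 :\ v|.+1 by rewrite (cardsD1 v B1) vB1.
have rD : r (B1 :\ v) = #|B1 :\ v|.
  have := rank_card (B1 :\ v); have := rankS rP (B1 :\ v) v.
  by rewrite setD1K // => /andP[_]; lia.
case: (pickP [pred w in B2 :\: B1 | r (w |: B1 :\ v) != r (B1 :\ v)]).
  move=> w /andP[wB rw]; exists w => //; rewrite inE.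
  have := rankS rP (B1 :\ v) w.
  have wB1 : w \notin B1 :\ v by move: wB; rewrite !inE; case: (w \in B1); rewrite ?andbF.
  rewrite cardsU1 wB1 => /andP[? ?]; move/eqP: rw => rw.
  by apply/andP; split; apply/eqP; lia.
move=> none; have : r (B1 :\ v :|: B2) = r (B1 :\ v).
  apply: rankU_eq => w wB2; case: (boolP (w \in B1)) => wB1.
    rewrite (setUidPr _) // sub1set !inE wB1 andbT.
    by apply: contraNneq vB2 => <-.
  by have := none w; rewrite /= !inE wB2 wB1 /= => /negbFE/eqP.
have := rank_le (subsetUr (B1 :\ v) B2); lia.
Qed.

(** * Greedy bases *)

Section Greedy.
Variable s : 'S_n.

Definition prefix_set (k : nat) : {set 'I_n} := [set s m | m : 'I_n & (m < k)%N].

(** The output of the greedy algorithm scanning the ground set in the order of [s]; [(s^-1)%g v] is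
    the position of [v]. *)
Definition greedy_basis : {set 'I_n} :=
  [set v | r (prefix_set ((s^-1)%g v).+1) != r (prefix_set ((s^-1)%g v))].

Lemma mem_prefix k m : (s m \in prefix_set k) = (m < k)%N.
Proof.
apply/imsetP/idP => [[m' + /perm_inj ->]|mk]; first by rewrite inE.
by exists m; rewrite ?inE.
Qed.

Lemma prefix0 : prefix_set 0 = set0.
Proof. by apply/setP => v; rewrite -[v](permKV s) mem_prefix inE. Qed.

Lemma prefixT : prefix_set n = [set: 'I_n].
Proof. by apply/setP => v; rewrite -[v](permKV s) mem_prefix inE ltn_ord. Qed.

Lemma prefixS (k : 'I_n) : prefix_set k.+1 = s k |: prefix_set k.
Proof.
apply/setP => v; rewrite -[v](permKV s) !inE !mem_prefix (inj_eq perm_inj).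
by rewrite ltnS leq_eqVlt.
Qed.

(** Spanning and independence go through one induction: by diminishing returns, an element that
    raises the rank of a prefix also raises the rank of its greedy part. *)
Lemma greedy_rank k : (k <= n)%N ->
  r (greedy_basis :&: prefix_set k) = r (prefix_set k)
  /\ #|greedy_basis :&: prefix_set k| = r (prefix_set k).
Proof.
elim: k => [|k IH] kn; first by rewrite prefix0 setI0 cards0 (rank0 rP).
have [IH1 IH2] := IH (ltnW kn); pose o := Ordinal kn.
have -> : prefix_set k.+1 = s o |: prefix_set k by apply: (prefixS o).
have sok : s o \notin prefix_set k by rewrite mem_prefix ltnn.
have := rankS rP (prefix_set k) (s o).
have so : (s o \in greedy_basis) = (r (s o |: prefix_set k) != r (prefix_set k)).
  by rewrite inE permK (prefixS o).
case: (boolP (s o \in greedy_basis)) => sB.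
  have -> : greedy_basis :&: (s o |: prefix_set k) =
           s o |: (greedy_basis :&: prefix_set k).
    by rewrite setIUr (setIidPr _) ?sub1set.
  rewrite cardsU1 !inE (negbTE sok) andbF /= IH2.
  have := rankS rP (greedy_basis :&: prefix_set k) (s o).
  have := rank_submod1 (s o) (subsetIr greedy_basis (prefix_set k)).
  move: sB; rewrite so IH1 => /eqP.
  set a := r (s o |: prefix_set k); set b := r (s o |: _); set c := r (prefix_set k).
  by clearbody a b c; split; lia.
have -> : greedy_basis :&: (s o |: prefix_set k) = greedy_basis :&: prefix_set k.
  apply/setP => v; rewrite !in_setI in_setU1; case: eqVneq => // ->.
  by rewrite (negbTE sB).
by move: sB; rewrite so => /negbNE/eqP ->; rewrite IH1 IH2.
Qed.

Lemma greedy_basis_in : greedy_basis \in rank_bases.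
Proof.
have [] := greedy_rank (leqnn n); rewrite prefixT setIT inE => -> ->.
by rewrite eqxx.
Qed.

End Greedy.

Lemma rank_bases_nonempty : rank_bases != set0.
Proof. by apply/set0Pn; exists (greedy_basis 1); exact: greedy_basis_in. Qed.

Definition rank_matroid := Matroid rank_bases_nonempty rank_bases_exchange.

(** Increments of the rank are 0 or 1, so submodularity is strict only when [i] and [j] become
    parallel non-loops after contracting [K]. *)
Lemma rank_ciP K i j :
  (r (i |: (j |: K)) + r K == r (i |: K) + r (j |: K))%N =
  ~~ [&& r (i |: K) != r K, r (j |: K) != r K & r (i |: (j |: K)) == r (j |: K)].
Proof.
have := rank_submod1 i (subsetUr [set j] K).
have := rankS rP K i; have := rankS rP K j; have := rankS rP (j |: K) i.
have := rank_le (_ : i |: K \subset i |: (j |: K)); rewrite setUS ?subsetUr // => /(_ isT).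
set a := r (i |: (j |: K)); set b := r (i |: K); set c := r (j |: K); set d := r K.
by clearbody a b c d; lia.
Qed.

Lemma rank_ci_eq K i j :
  ~ [/\ r (i |: K) != r K, r (j |: K) != r K & r (i |: (j |: K)) == r (j |: K)] ->
  (r (i |: (j |: K)) + r K = r (i |: K) + r (j |: K))%N.
Proof. by move=> h; apply/eqP; rewrite rank_ciP; apply/and3P. Qed.

Lemma rank_ci_lt K i j :
  r (i |: K) != r K -> r (j |: K) != r K -> r (i |: (j |: K)) == r (j |: K) ->
  (r (i |: (j |: K)) + r K < r (i |: K) + r (j |: K))%N.
Proof.
move=> ri rj rij; rewrite ltn_neqAle rank_ciP ri rj rij /=.
by apply: rank_submod1; apply: subsetUr.
Qed.

End RankFunction.

(** This makes the CI relations of a sum of rank functions the ones common to all summands. *)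
Lemma eq_sum_leq (I : eqType) (s : seq I) (F F' G G' : I -> nat) :
  (forall m, F m + F' m <= G m + G' m)%N ->
  (\sum_(m <- s) G m + \sum_(m <- s) G' m = \sum_(m <- s) F m + \sum_(m <- s) F' m)%N
  <-> {in s, forall m, F m + F' m = G m + G' m}%N.
Proof.
move=> leFG; rewrite -!big_split /=; split=> [eqFG m ms|eqFG]; last first.
  by apply: eq_big_seq => m /eqFG.
apply/eqP; rewrite eqn_leq leFG leqNgt; apply/negP => lt_m.
have := leq_add lt_m (leq_sum (rem m s) (fun m' (_ : true) => leFG m')).
by move: eqFG; rewrite (big_rem m ms) [RHS](big_rem m ms) /= addSn => ->; rewrite ltnn.
Qed.

(** * Ranks of coordinate functions on a linear space *)

Section LinearRank.
Variables (F : fieldType) (n : nat) (Z : 'M[F]_n).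
Implicit Types (A B K : {set 'I_n}) (x : 'rV[F]_n).

Definition vanishing A : 'M[F]_n :=
  (Z :&: kermx (diag_mx (\row_(v < n) (v \in A)%B%:R)))%MS.

(** By rank-nullity, this is the dimension of the span of the coordinate functions of [A] restricted
    to the row space of [Z]. *)
Definition linear_rank A : nat := (\rank Z - \rank (vanishing A))%N.

Lemma vanishingP A x :
  reflect ((x <= Z)%MS /\ {in A, forall v, x 0 v = 0}) (x <= vanishing A)%MS.
Proof.
rewrite sub_capmx; apply: (iffP andP) => -[xZ]; rewrite sub_kermx.
  move=> /eqP/rowP xA; split=> // v vA; have := xA v.
  by rewrite mul_mx_diag !mxE vA mulr1.
move=> xA; split=> //; apply/eqP/rowP => v; rewrite mul_mx_diag !mxE.
by case: (boolP (v \in A)) => [/xA ->|_]; rewrite ?mul0r ?mulr0.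
Qed.

Lemma vanishing_sub A B : A \subset B -> (vanishing B <= vanishing A)%MS.
Proof.
move=> /fintype.subsetP sAB; apply/rV_subP => x /vanishingP[xZ xB].
by apply/vanishingP; split=> // v /sAB; apply: xB.
Qed.

Lemma vanishingU A B : (vanishing (A :|: B) :=: vanishing A :&: vanishing B)%MS.
Proof.
apply/eqmxP; rewrite sub_capmx !vanishing_sub ?subsetUl ?subsetUr //=.
apply/rV_subP => x; rewrite sub_capmx => /andP[/vanishingP[xZ xA] /vanishingP[_ xB]].
by apply/vanishingP; split=> // v /setUP[/xA|/xB].
Qed.

(** A new element imposes one more linear equation, hence unit increments. Submodularity is the
    dimension formula for [vanishing A] and [vanishing B], whose sum lies in
    [vanishing (A :&: B)]. *)
Lemma linear_rank_function : rank_function linear_rank.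
Proof.
have le_rk A : (\rank (vanishing A) <= \rank Z)%N by apply: mxrankS; apply: capmxSl.
split=> [|A v|A B]; rewrite /linear_rank.
- apply/eqP; rewrite subn_eq0; apply: mxrankS; apply/rV_subP => x xZ.
  by apply/vanishingP; split=> // v; rewrite inE.
- have := mxrank_mul_ker (vanishing A) (delta_mx v ord0 : 'cV[F]_n).
  have := rank_leq_col (vanishing A *m (delta_mx v ord0 : 'cV[F]_n)).
  have := mxrankS (vanishing_sub (subsetUr [set v] A)).
  have : (\rank (vanishing A :&: kermx (delta_mx v ord0 : 'cV[F]_n)) <=
          \rank (vanishing (v |: A)))%N.
    apply: mxrankS; apply/rV_subP => x.
    rewrite sub_capmx sub_kermx => /andP[/vanishingP[xZ xA] /eqP xv].
    apply/vanishingP; split=> // w /setU1P[->|/xA //].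
    by have := congr1 (fun M : 'M[F]_1 => M ord0 ord0) xv; rewrite -colE !mxE.
  have := le_rk A; have := le_rk (v |: A); lia.
- have := mxrank_sum_cap (vanishing A) (vanishing B).
  rewrite -(vanishingU A B).
  have : (\rank (vanishing A + vanishing B) <= \rank (vanishing (A :&: B)))%N.
    by apply: mxrankS; rewrite addsmx_sub !vanishing_sub ?subsetIl ?subsetIr.
  have := le_rk A; have := le_rk B; have := le_rk (A :|: B); have := le_rk (A :&: B).
  lia.
Qed.

Lemma linear_rankU1 A v : (linear_rank (v |: A) == linear_rank A) =
  `[< forall x, (x <= vanishing A)%MS -> x 0 v = 0 >].
Proof.
have le_rk B : (\rank (vanishing B) <= \rank Z)%N by apply: mxrankS; apply: capmxSl.
have sub := vanishing_sub (subsetUr [set v] A).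
have -> : (linear_rank (v |: A) == linear_rank A) =
          (vanishing A <= vanishing (v |: A))%MS.
  have := mxrank_leqif_sup sub => -[le <-].
  rewrite /linear_rank; move: (le_rk A) (le_rk (v |: A)) le; lia.
apply/idP/asboolP => [sAv x xA|h].
  by have /vanishingP[_ ->] := submx_trans xA sAv; rewrite ?setU11.
apply/rV_subP => x xA; have xv := h x xA; case/vanishingP: xA => xZ xA.
by apply/vanishingP; split=> // w /setU1P[->|/xA].
Qed.

End LinearRank.

(** * The Bayes ball as a walk on directed states *)

(* The state [(v, true)] means that the ball has entered [v] along an edge
   pointing into [v], and [(v, false)] that it has entered [v] from a child of
   [v] or starts at [v]. *)
Definition ball_step n (G : rel 'I_n) (K : {set 'I_n}) : rel ('I_n * bool) :=
  fun s t => (if t.2 then G s.1 t.1 else G t.1 s.1)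
             && (if s.2 && ~~ t.2 then s.1 \in K else s.1 \notin K).

Section Acyclic.
Variables (n : nat) (G : rel 'I_n) (dagG : acyclic G).

Lemma acyclic_asym a b : G a b -> ~~ G b a.
Proof.
move=> Gab; apply/negP => Gba.
by have := dagG (c := [:: a; b]); rewrite /= Gab Gba => /(_ isT).
Qed.

(** The height counts ancestors. Along an edge from [a] to [b] the node [b] is a new one, since
    otherwise the edge would close a cycle. *)
Lemma acyclic_height : exists h : 'I_n -> nat, forall a b, G a b -> (h a < h b)%N.
Proof.
exists (fun v => #|[pred u | connect G u v]|) => a b Gab; apply: proper_card.
apply/properP; split.
  apply/fintype.subsetP => u; rewrite !inE => ua.
  by apply: connect_trans ua (connect1 Gab).
exists b; rewrite !inE ?connect0 //; apply/negP => /connectP[p Gp aE].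
have /dagG : path.cycle G (b :: p) by rewrite /= rcons_path Gp -aE.
by [].
Qed.

(** Once the direction of the last edge is part of the state, the condition on triples becomes a
    condition on single steps. The start state only requires [i] to be outside [K], which is the
    hypothesis. *)
Lemma bayes_ball_walk (i j : 'I_n) (K : {set 'I_n}) : i \notin K ->
  (exists p, bayes_ball_path G i j K p) <->
  (exists2 q, path (ball_step G K) (i, false) q & (last (i, false) q).1 = j).
Proof.
move=> iK; split=> [[p [adj_p last_p trip]]|[q path_q last_q]].
  pose tr := pairmap (fun v w => (w, G v w)).
  have tr_last s p' : (last s (tr s.1 p')).1 = last s.1 p'.
    by elim: p' s => //= v p' IH s; rewrite IH.
  exists (tr i p); last by rewrite (tr_last (i, false)).
  have walk a b p' : adjacent G a b -> path (adjacent G) b p' ->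
    (forall x y z, infix [:: x; y; z] (a :: b :: p') ->
        ([|| G x y && G y z, G y x && G y z | G y x && G z y] -> y \notin K)
        /\ (G x y && G z y -> y \in K)) ->
    path (ball_step G K) (b, G a b) (tr b p').
    elim: p' a b => //= c p' IH a b ab /andP[bc p'P] trip'.
    apply/andP; split; last first.
      by apply: IH => // x y z inf; apply: trip'; rewrite inf orbT.
    have [|t1 t2] := trip' a b c; first by rewrite /= !eqxx prefix0s.
    move: ab bc t1 t2; rewrite /ball_step /adjacent /=.
    by case: (G a b); case: (G b a); case: (G b c); case: (G c b) => //=; auto.
  case: p adj_p trip {last_p} => //= b p /andP[ib pP] trip.
  rewrite walk // andbT /ball_step /= iK andbT.
  by case: ifP => // Gib; move: ib; rewrite /adjacent /= Gib.
exists (map fst q); split.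
- rewrite -{1}[i]/((i, false).1).
  elim: q (i, false) path_q {last_q} => //= t q IH s /andP[/andP[st _] /IH ->].
  by rewrite andbT /adjacent /=; case: t.2 st => ->; rewrite ?orbT.
- by rewrite -last_q -[i]/((i, false).1) last_map.
- rewrite -[i]/((i, false).1).
  elim: q (i, false) path_q {last_q} => [|t q IH] s.
    by move=> _ a b c /=; rewrite !andbF.
  move=> /= /andP[st tq] a b c /orP[|]; last by apply: IH.
  case: q tq {IH} => [|u q] /=; first by rewrite !andbF.
  case/andP=> tu _ /and4P[/eqP-> /eqP-> /eqP-> _].
  move: st tu; rewrite /ball_step.
  have := @acyclic_asym s.1 t.1; have := @acyclic_asym t.1 u.1.
  case: (G s.1 t.1); case: (G t.1 s.1); case: (G t.1 u.1); case: (G u.1 t.1) => h1 h2;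
    try (by have := h1 isT); try (by have := h2 isT);
    by case: t.2; case: u.2; case: (t.1 \in K); case: s.2 => //=; case: (s.1 \in K).
Qed.

Lemma d_separatedP (i j : 'I_n) (K : {set 'I_n}) : i \notin K ->
  d_separated G i j K <->
  forall d, ~~ connect (ball_step G K) (i, false) (j, d).
Proof.
move=> iK; rewrite /d_separated (bayes_ball_walk j iK); split.
  by move=> h d; apply/negP => /connectP[q qP qj]; apply: h; exists q; rewrite // -qj.
move=> h [q qP qj]; have /negP := h (last (i, false) q).2; apply.
by apply/connectP; exists q => //; rewrite -qj; case: (last _ _).
Qed.

End Acyclic.

(** * Linear structural equation models *)

Section Model.
Variables (F : fieldType) (n : nat).
Implicit Types (S K : {set 'I_n}) (E G : rel 'I_n) (x : 'I_n -> F).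

(* Each variable outside [S] is the sum of its parents for [E]; the variables
   in [S] are free. *)
Definition model_sol S E x : Prop :=
  forall v, v \notin S -> x v = \sum_(p | E p v) x p.

Definition model_mx E : 'M[F]_n := \matrix_(p, v) ((p == v)%:R - (E p v)%:R).

(** The diagonal factor discards the equations at the nodes of [S]. *)
Definition model_space S E : 'M[F]_n :=
  kermx (model_mx E *m diag_mx (\row_(v < n) (v \notin S)%B%:R)).

Lemma mul_model_mx E (x : 'rV[F]_n) v :
  (x *m model_mx E) 0 v = x 0 v - \sum_(p | E p v) x 0 p.
Proof.
have -> : x 0 v = \sum_p (if p == v then x 0 p else 0) by rewrite -big_mkcond big_pred1_eq.
rewrite mxE [X in _ - X]big_mkcond -sumrB; apply: eq_bigr => p _; rewrite !mxE mulrBr.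
by rewrite !mulr_natr; case: (p == v); case: (E p v).
Qed.

Lemma model_spaceP S E (x : 'rV[F]_n) :
  reflect (model_sol S E (x 0)) (x <= model_space S E)%MS.
Proof.
rewrite sub_kermx mulmxA; apply: (iffP eqP) => [/rowP xS v vS|xS].
  have := xS v; rewrite mul_mx_diag mxE mul_model_mx !mxE vS mulr1.
  by move/eqP; rewrite subr_eq0 => /eqP.
apply/rowP => v; rewrite mul_mx_diag mxE mul_model_mx !mxE.
by case: (boolP (v \in S)) => [|/xS ->]; rewrite ?mulr0 // subrr mul0r.
Qed.

(** Along the height of [G] the matrix [model_mx E] is unitriangular, hence invertible, so any error
    terms [e] can be prescribed. *)
Lemma model_solve G E (e : 'I_n -> F) : acyclic G -> subrel E G ->
  exists x, forall v, x v = \sum_(p | E p v) x p + e v.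
Proof.
move=> dagG sEG; have [h hG] := acyclic_height dagG.
have free : row_free (model_mx E).
  rewrite -kermx_eq0; apply/rowV0P => x; rewrite sub_kermx => /eqP x0.
  apply/rowP => v; rewrite mxE.
  have [m] := ubnP (h v); elim: m v => // m IH v /ltnSE vm.
  have := congr1 (fun y : 'rV_n => y 0 v) x0.
  rewrite mul_model_mx mxE => /eqP; rewrite subr_eq0 => /eqP ->.
  rewrite big1 // => p /sEG/hG pv; apply: IH; exact: leq_trans pv vm.
pose x := (\row_v e v) *m invmx (model_mx E).
exists (x 0) => v.
have := congr1 (fun y : 'rV_n => y 0 v)
  (mulmxKV (_ : model_mx E \in unitmx) (\row_v e v)).
rewrite -row_free_unit free => /(_ isT); rewrite mul_model_mx [X in _ = X -> _]mxE => <-.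
by rewrite addrC subrK.
Qed.

Lemma model_sound G S E K i j x : acyclic G -> subrel E G ->
    i \notin K -> d_separated G i j K ->
    model_sol S E x -> {in K, forall v, x v = 0} ->
  exists y, [/\ model_sol S E y, {in K, forall v, y v = 0}, y i = x i & y j = 0].
Proof.
move=> dagG sEG iK /(d_separatedP dagG j iK) sep xS xK.
have [h hG] := acyclic_height dagG.
pose reach := connect (ball_step G K) (i, false).
(* [T] holds the nodes outside [K] that are reached from a child or as the start, so that the ball
   can leave them upwards; [D] holds those entered along an edge pointing into them. *)
pose T v := (v \notin K) && reach (v, false).
pose D v := reach (v, true).
have reach_step s t : reach s -> ball_step G K s t -> reach t.
  by move=> rs st; apply: connect_trans rs (connect1 st).
have down_T p v : G p v -> T p -> D v.
  by move=> pv /andP[pK /reach_step]; apply; rewrite /ball_step /= pv pK.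
have down_D p v : G p v -> p \notin K -> D p -> D v.
  by move=> pv pK /reach_step; apply; rewrite /ball_step /= pv pK.
have T_par p v : G p v -> T v -> p \notin K -> T p.
  move=> pv /andP[vK vr] pK; rewrite /T pK; apply: reach_step vr _.
  by rewrite /ball_step /= pv vK.
(* A ball moving down inside the ancestors of [K] bounces back upwards. *)
pose anc v := [exists k in K, connect G v k].
have anc_par p v : G p v -> anc v -> anc p.
  move=> pv /existsP[k /andP[kK vk]]; apply/existsP; exists k; rewrite kK /=.
  exact: connect_trans (connect1 pv) vk.
have bounce v : anc v -> D v -> forall p, G p v -> p \notin K -> T p.
  move=> /existsP[k /andP[kK /connectP[q]]].
  elim: q v => [|w q IH] v /=.
    move=> _ <- Dv p pv pK; rewrite /T pK; apply: reach_step Dv _.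
    by rewrite /ball_step /= pv kK.
  case/andP=> vw wq wk Dv p pv pK; case: (boolP (v \in K)) => vK.
    by rewrite /T pK; apply: reach_step Dv _; rewrite /ball_step /= pv vK.
  apply: (T_par p v) => //; apply: (IH w) => //; exact: down_D Dv.
(* The residual of [x] is kept on [T], and also at nodes of [K] with a parent in [T], where it
   brings the value back to 0. It vanishes outside [S], so [y] still solves the model. *)
pose e v := if T v || ((v \in K) && [exists p, G p v && T p])
            then x v - \sum_(p | E p v) x p else 0.
have [y yE] := model_solve e dagG sEG.
(* Induction on the height. The clause about ancestors of [K] supplies the zeros at parents in [K],
   which the other two clauses need. *)
have y_claim v : [/\ T v -> y v = x v, anc v && ~~ T v -> y v = 0
                   & ~~ T v -> ~~ D v -> y v = 0].
  have [m] := ubnP (h v); elim: m v => // m IH v /ltnSE vm.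
  have {}IH p : E p v -> [/\ T p -> y p = x p, anc p && ~~ T p -> y p = 0
                   & ~~ T p -> ~~ D p -> y p = 0].
    by move=> /sEG/hG pv; apply: IH; apply: leq_trans pv vm.
  have ancK k : k \in K -> anc k by move=> kK; apply/existsP; exists k; rewrite kK /=.
  have KT k : k \in K -> ~~ T k by rewrite /T => ->.
  have sum_x : (forall p, E p v -> p \notin K -> T p) ->
      \sum_(p | E p v) y p = \sum_(p | E p v) x p.
    move=> pT; apply: eq_bigr => p pv; have [IH1 IH2 _] := IH p pv.
    case: (boolP (p \in K)) => [pK|/(pT p pv)/IH1 //].
    by rewrite IH2 ?xK // ancK // KT.
  split.
  - move=> Tv; rewrite yE /e Tv /= sum_x; first by rewrite addrC subrK.
    by move=> p /sEG pv pK; apply: T_par Tv pK.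
  - case/andP=> av nTv; rewrite yE /e (negbTE nTv) /=.
    (* If [v] has a parent in [T], the ball enters [v] downwards and bounces, so all parents of [v]
       outside [K] are in [T]. Then [v] is in [K], since otherwise a bounce at a child would put [v]
       in [T]. Without a parent in [T], all terms vanish by induction. *)
    case: (boolP [exists p, G p v && T p]) => [/existsP[p0 /andP[p0v Tp0]]|/existsPn nT].
      have Tall p : E p v -> p \notin K -> T p.
        by move=> /sEG pv pK; apply: (bounce v) => //; apply: down_T Tp0.
      case: (boolP (v \in K)) => vK; rewrite /= sum_x //; first by rewrite addrC subrK xK.
      exfalso; move/negP: nTv; apply; rewrite /T vK.
      have /existsP[k /andP[kK /connectP[q]]] := av.
      case: q => [/= _ kE|w q /= /andP[vw wq] kE]; first by rewrite -kE kK in vK.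
      have aw : anc w by apply/existsP; exists k; rewrite kK; apply/connectP; exists q.
      have /andP[] // : T v.
      by apply: (bounce w) => //; apply: down_D vw vK _; apply: down_T Tp0.
    rewrite andbF addr0 big1 // => p pv; have [_ IH2 _] := IH p pv; apply: IH2.
    by rewrite (anc_par p v) ?sEG //=; have := nT p; rewrite (sEG _ _ pv).
  - move=> nTv nDv; have nTp p : E p v -> ~~ T p.
      by move=> /sEG pv; apply: contra nDv; apply: down_T.
    rewrite yE /e (negbTE nTv) /= big1 ?add0r.
      case: ifP => // /andP[_ /existsP[p /andP[pv /(down_T p v pv)]]].
      by rewrite (negbTE nDv).
    move=> p pv; have [_ IH2 IH3] := IH p pv.
    case: (boolP (p \in K)) => pK; first by rewrite IH2 ?nTp ?ancK.
    apply: IH3; first exact: nTp.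
    by apply: contra nDv; apply: down_D; rewrite ?sEG.
exists y; split.
- move=> v vS; rewrite yE /e; case: ifP; rewrite ?addr0 // -xS // subrr addr0 //.
- move=> v vK; have [_ yv _] := y_claim v; apply: yv.
  by rewrite /T vK /= andbT; apply/existsP; exists v; rewrite vK /=.
- by have [yi _ _] := y_claim i; apply: yi; rewrite /T iK /reach connect0.
- have [_ _ yj] := y_claim j; apply: yj; last exact: sep.
  by rewrite negb_and; apply/orP; right; apply: sep.
Qed.

End Model.

(** * Models linking d-connected nodes *)

Section Complete.
Variable n : nat.
Implicit Types (i j k c v : 'I_n) (K S : {set 'I_n}) (G E : rel 'I_n).
Implicit Types (x : 'I_n -> 'F_2) (q : seq ('I_n * bool)).

(* Some model on a subgraph of [G] makes the variables [i] and [j] equal and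
   not identically zero once those in [K] vanish. *)
Definition linked G i j K : Prop :=
  exists S E, [/\ subrel E G,
    forall x, model_sol S E x -> {in K, forall v, x v = 0} -> x i = x j
    & exists x, [/\ model_sol S E x, {in K, forall v, x v = 0} & x i = 1]].

Lemma sum_update E x i a v : ~~ E i v ->
  \sum_(p | E p v) [eta x with i |-> a] p = \sum_(p | E p v) x p.
Proof.
move=> Eiv; apply: eq_bigr => p pv /=; case: eqVneq => // pi.
by rewrite -pi pv in Eiv.
Qed.

Definition del_nodes G (X : pred 'I_n) : rel 'I_n :=
  [rel a b | [&& G a b, ~~ X a & ~~ X b]].

Lemma addFF2 (a : 'F_2) : a + a = 0.
Proof. by rewrite -mulr2n -mulr_natr (_ : 2%:R = 0) ?mulr0 //; apply: val_inj. Qed.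

Lemma addF2_eq0 (a b : 'F_2) : a + b = 0 -> a = b.
Proof. by move=> ab; rewrite -[a]addr0 -(addFF2 b) addrA ab add0r. Qed.

Lemma linked_refl G i K : i \notin K -> linked G i i K.
Proof.
move=> iK; exists [set i], (fun _ _ => false); split=> //.
exists (fun v => (v == i)%:R); split=> [v|v vK|]; last by rewrite eqxx.
  by rewrite inE big_pred0_eq => /negbTE->.
by case: eqVneq => // vi; rewrite -vi vK in iK.
Qed.

(** The node [i] is put back as a copy of its parent [p1]. *)
Lemma linked_parent G i j p1 K : G p1 i -> i != p1 -> i != j -> i \notin K ->
  linked (del_nodes G (pred1 i)) p1 j K -> linked G i j K.
Proof.
move=> Gpi ip ij iK [S [E [sEG fwd [x [xS xK x1]]]]].
have Ei v : ~~ E i v by apply/negP => /sEG /and3P[_ /=]; rewrite eqxx.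
have Ei' v : ~~ E v i by apply/negP => /sEG /and3P[_ _ /=]; rewrite eqxx.
exists (S :\ i), (fun p v => if v == i then p == p1 else E p v); split.
- move=> p v; case: eqVneq => [-> /eqP -> //|_ /sEG /and3P[] //].
- move=> y yS yK.
  have yi : y i = y p1.
    by rewrite yS ?setD11 // eqxx big_pred1_eq.
  (* In the smaller model [i] is isolated, so the value 0 satisfies its equation whether or not [i]
     is free. *)
  have := fwd [eta y with i |-> 0]; rewrite /= eq_sym (negbTE ip) eq_sym (negbTE ij) yi.
  apply=> [v|v vK /=]; last by case: eqP => // _; apply: yK.
  rewrite sum_update //= => vS; case: eqVneq => [->|vi].
    by rewrite big_pred0 // => p; apply: negbTE.
  by rewrite yS ?inE ?vi //= (negbTE vi).
- exists [eta x with i |-> x p1]; split=> [v|v vK /=|]; last by rewrite /= eqxx.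
    rewrite !inE negb_and negbK /=; case: eqVneq => [-> _|vi /= vS].
      by rewrite big_pred1_eq /= eq_sym (negbTE ip).
    by rewrite sum_update // xS.
  by case: eqVneq => [vi|_]; [rewrite -vi vK in iK|apply: xK].
Qed.

(** The node [i] is put back as a free node and its child [p1] becomes a copy of it. This requires
    that the smaller model has no edge into [p1]. *)
Lemma linked_child G i j p1 K :
  G i p1 -> i != p1 -> i != j -> i \notin K -> p1 \notin K ->
  linked [rel a b | del_nodes G (pred1 i) a b && (b != p1)] p1 j K -> linked G i j K.
Proof.
move=> Gip ip ij iK pK [S [E [sEG fwd [x [xS xK x1]]]]].
have Ei v : ~~ E i v by apply/negP => /sEG /andP[/and3P[_ /=]]; rewrite eqxx.
have Ei' v : ~~ E v i by apply/negP => /sEG /andP[/and3P[_ _ /=]]; rewrite eqxx.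
have Ep v : ~~ E v p1 by apply/negP => /sEG /andP[_]; rewrite eqxx.
(* A node without parents that is not free has value 0, whereas [x p1 = 1]. *)
have pS : p1 \in S.
  apply: contraT => /xS /eqP; rewrite x1 big_pred0 // => p.
  exact/negbTE.
exists (i |: S :\ p1), (fun p v => if v == p1 then p == i else E p v); split.
- move=> p v; case: eqVneq => [-> /eqP -> //|_ /sEG /andP[/and3P[] //]].
- move=> y yS yK.
  have yi : y p1 = y i.
    by rewrite yS ?eqxx ?big_pred1_eq // !inE eqxx /= orbF eq_sym.
  have := fwd [eta y with i |-> 0]; rewrite /= eq_sym (negbTE ip) eq_sym (negbTE ij) yi.
  apply=> [v|v vK /=]; last by case: eqP => // _; apply: yK.
  rewrite sum_update //= => vS; case: eqVneq => [->|vi].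
    by rewrite big_pred0 // => p; apply: negbTE.
  have vp : v != p1 by apply: contraNneq vS => ->.
  by rewrite yS ?inE ?negb_or ?vi ?negb_and ?vS ?orbT //= (negbTE vp).
- exists [eta x with i |-> x p1]; split=> [v|v vK /=|]; last by rewrite /= eqxx.
    rewrite !inE negb_or negb_and negbK /= => /andP[vi].
    rewrite (negbTE vi); case: eqVneq => [-> _|vp /= vS].
      by rewrite big_pred1_eq /= eqxx.
    by rewrite sum_update // xS.
  by case: eqVneq => [vi|_]; [rewrite -vi vK in iK|apply: xK].
Qed.

(** The node [i] is free and [k] is put back as the sum of [i] and [p2]. In characteristic 2 the
    vanishing of [k] says that these two are equal. *)
Lemma linked_collider G i j k p2 K :
  G i k -> G p2 k -> i != k -> i != p2 -> k != p2 -> i != j -> k != j ->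
  i \notin K -> k \in K ->
  linked (del_nodes G (pred2 i k)) p2 j (K :\ k) -> linked G i j K.
Proof.
move=> Gik Gpk ik ip kp ij kj iK kK [S [E [sEG fwd [x [xS xK x1]]]]].
have Ei v : ~~ E i v by apply/negP => /sEG /and3P[_ /=]; rewrite eqxx.
have Ei' v : ~~ E v i by apply/negP => /sEG /and3P[_ _ /=]; rewrite eqxx.
have Ek v : ~~ E k v by apply/negP => /sEG /and3P[_ /=]; rewrite eqxx orbT.
have Ek' v : ~~ E v k by apply/negP => /sEG /and3P[_ _ /=]; rewrite eqxx orbT.
have sum_k y : \sum_(p | (p == i) || (p == p2)) y p = y i + y p2 :> 'F_2.
  rewrite (bigD1 i) ?eqxx //= (bigD1 p2) ?eqxx ?orbT 1?eq_sym //= addrA big1 ?addr0 //.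
  by move=> p /andP[/andP[/orP[|] /eqP->]]; rewrite eqxx.
exists (i |: S :\ k), (fun p v => if v == k then (p == i) || (p == p2) else E p v); split.
- move=> p v; case: eqVneq => [-> /orP[] /eqP -> //|_ /sEG /and3P[] //].
- move=> y yS yK.
  have yk : y k = y i + y p2.
    by rewrite yS ?eqxx ?sum_k // !inE eqxx /= orbF eq_sym.
  have {}yk : y i = y p2 by apply: addF2_eq0; rewrite -yk yK ?kK.
  have := fwd [eta y with i |-> 0]; rewrite /= eq_sym (negbTE ip) eq_sym (negbTE ij) yk.
  apply=> [v|v /setD1P[_ vK] /=]; last by case: eqP => // _; apply: yK.
  rewrite sum_update //= => vS; case: eqVneq => [->|vi].
    by rewrite big_pred0 // => p; apply: negbTE.
  case: (eqVneq v k) => [->|vk].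
    by rewrite yK // big_pred0 // => p; apply: negbTE.
  by rewrite yS ?inE ?negb_or ?vi ?negb_and ?vS ?orbT //= (negbTE vk).
- exists [eta [eta x with k |-> 0] with i |-> x p2].
  split=> [v|v vK /=|]; last by rewrite /= eqxx.
    rewrite !inE negb_or negb_and negbK /= => /andP[vi].
    rewrite (negbTE vi); case: eqVneq => [-> _|vk /= vS].
      rewrite sum_k /= eqxx eq_sym (negbTE ip) eq_sym (negbTE kp).
      by rewrite addFF2.
    by rewrite !sum_update // xS.
  case: eqVneq => [vi|_]; first by rewrite -vi vK in iK.
  by case: eqVneq => // vk; apply: xK; rewrite !inE vk.
Qed.

(** The node [k] is put back as a copy of [c], so that requiring [k] to vanish amounts to requiring
    this of [c]. *)
Lemma linked_contract G i j k c K :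
  G c k -> c != k -> i != k -> j != k -> k \in K ->
  linked (del_nodes G (pred1 k)) i j (c |: K :\ k) -> linked G i j K.
Proof.
move=> Gck ck ik jk kK [S [E [sEG fwd [x [xS xK x1]]]]].
have Ek v : ~~ E k v by apply/negP => /sEG /and3P[_ /=]; rewrite eqxx.
have Ek' v : ~~ E v k by apply/negP => /sEG /and3P[_ _ /=]; rewrite eqxx.
exists (S :\ k), (fun p v => if v == k then p == c else E p v); split.
- move=> p v; case: eqVneq => [-> /eqP -> //|_ /sEG /and3P[] //].
- move=> y yS yK.
  have yc : y c = 0 by rewrite -(yK k kK) [RHS]yS ?setD11 // eqxx big_pred1_eq.
  apply: fwd => [v vS|v /setU1P[->//|/setD1P[_ /yK]//]].
  case: (eqVneq v k) => [->|vk].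
    by rewrite yK // big_pred0 // => p; apply: negbTE.
  by rewrite yS ?inE ?vk //= (negbTE vk).
- have xc : x c = 0 by apply: xK; rewrite setU11.
  exists [eta x with k |-> 0]; split=> [v|v vK /=|]; last by rewrite /= (negbTE ik).
    rewrite !inE negb_and negbK /=; case: eqVneq => [-> _|vk /= vS].
      by rewrite big_pred1_eq /= (negbTE ck).
    by rewrite sum_update // xS.
  by case: eqVneq => // vk; apply: xK; rewrite !inE vk vK orbT.
Qed.

(** * Shortest Bayes ball walks *)

Fixpoint descent G K m v : bool :=
  if m is m'.+1 then [exists c, G v c && descent G K m' c] else v \in K.

(** A walk can turn from downwards to upwards only at a node of [K]. Its part before the first such
    turn descends from the start to [K], and its part after the last one, reversed, descends from
    [w] to [K]. A start in an upward state needs a given descent of its own, as there may be no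
    turn. *)
Lemma walk_descent G K s q w : path (ball_step G K) s q -> last s q = (w, false) ->
  if s.2 then exists m1 m2,
    [/\ descent G K m1 s.1, descent G K m2 w & (m1 + m2 <= size q)%N]
  else forall m, descent G K m s.1 ->
    exists2 m2, descent G K m2 w & (m2 <= m + size q)%N.
Proof.
elim: q s => [|t q IH] s /= => [_ -> /= m|].
  by exists m; rewrite ?addn0.
case/andP=> st tq tw; have := IH t tq tw; move: st; rewrite /ball_step.
case: s.2; case: t.2 => /= /andP[st sK].
- case=> m1 [m2 [d1 d2 le]]; exists m1.+1, m2; split=> //=.
  by apply/existsP; exists t.1; rewrite st.
- move=> IHt; have [|m2 d2 le] := IHt 1%N.
    by apply/existsP; exists s.1; rewrite st.
  by exists 0%N, m2; split.
- case=> m1 [m2 [d1 d2 le]] m _; exists m2 => //; lia.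
- move=> IHt m d; have [|m2 d2 le] := IHt m.+1.
    by apply/existsP; exists s.1; rewrite st.
  by exists m2 => //; lia.
Qed.

(* Down to [K] along a shortest directed path and back up the same way. *)
Lemma bounce_walk G K m v : descent G K m.+1 v ->
  (forall m', (m' <= m)%N -> ~~ descent G K m' v) ->
  exists q, [/\ path (ball_step G K) (v, true) q, last (v, true) q = (v, false),
    size q = m.+1.*2 & exists A c k B, k \in K /\
      (v, true) :: q = A ++ [:: (c, true), (k, true), (c, false) & B]].
Proof.
elim: m v => [|m IH] v /existsP[c /andP[vc cd]] minv; have vK := minv 0%N isT.
  exists [:: (c, true); (v, false)]; split=> //.
    by rewrite /= /ball_step /= vc vK; move: cd => /= ->.
  by exists [::], v, c, [::].
have minc m' : (m' <= m)%N -> ~~ descent G K m' c.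
  move=> m'm; have := minv m'.+1 m'm; apply: contra => d.
  by apply/existsP; exists c; rewrite vc.
have [q [qP ql qs [A [c' [k [B [kK qE]]]]]]] := IH c cd minc.
exists ((c, true) :: rcons q (v, false)); split.
- rewrite /= rcons_path qP ql /ball_step /= vc /=.
  by rewrite vK; have := minc 0%N isT.
- by rewrite /= last_rcons.
- by rewrite /= size_rcons qs.
- exists ((v, true) :: A), c', k, (rcons B (v, false)); split=> //.
  by rewrite -(rcons_cons (c, true)) qE /= rcons_cat.
Qed.

Lemma walk_not_in G K s q u : path (ball_step G K) s q ->
  (last s q).1 \notin K -> (u, false) \in s :: q -> u \notin K.
Proof.
elim: q s => [|t q IH] s /=; first by rewrite inE => _ + /eqP us; rewrite -us.
case/andP=> st tq lK; rewrite inE => /predU1P[us|]; last exact: IH.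
by move: st; rewrite -us /ball_step /= => /andP[].
Qed.

Lemma ball_step_sub G G' K K' (P : pred 'I_n) s t :
  (forall a b, P a -> P b -> G a b -> G' a b) ->
  (forall a, P a -> (a \in K) = (a \in K')) ->
  P s.1 -> P t.1 -> ball_step G K s t -> ball_step G' K' s t.
Proof.
move=> GG KK Ps Pt; rewrite /ball_step KK //.
by case: t.2 => /andP[st ->]; rewrite andbT GG.
Qed.

Lemma sub_walk G G' K K' (P : pred 'I_n) s q :
  (forall a b, P a -> P b -> G a b -> G' a b) ->
  (forall a, P a -> (a \in K) = (a \in K')) ->
  (forall t, t \in s :: q -> P t.1) ->
  path (ball_step G K) s q -> path (ball_step G' K') s q.
Proof.
move=> GG KK Pq; apply: (@sub_in_path _ [pred t | P t.1]); last by apply/allP.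
by move=> t u Pt Pu; apply: (ball_step_sub GG KK).
Qed.

(* Induction on the length of a shortest walk, over all graphs and all [K]: the
   first nodes of the walk are deleted and then put back as copies or sums of
   their neighbours on the walk. If the walk bounces back along [c -> k <- c]
   at some [k] in [K], then [k] is replaced by [c] in [K] instead. *)
Lemma walk_linked G i j K q : i \notin K -> j \notin K ->
  path (ball_step G K) (i, false) q -> (last (i, false) q).1 = j -> linked G i j K.
Proof.
have [m] := ubnP (size q); elim: m G i j K q => // m IH G i j K q /ltnSE qm iK jK.
move=> qP qj; apply: contrapT => nlink.
(* A shorter walk would link [i] and [j] by induction, so [q] may be taken shortest. *)
have qmin q' : path (ball_step G K) (i, false) q' -> (last (i, false) q').1 = j ->
    (size q <= size q')%N.
  move=> q'P q'j; rewrite leqNgt; apply/negP => lt; apply: nlink.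
  by apply: (IH G i j K q') => //; apply: leq_trans lt qm.
(* Stated for any walk of minimal length, because [q] is rerouted below. *)
have min_uniq q' : path (ball_step G K) (i, false) q' ->
    (last (i, false) q').1 = j -> (size q' <= size q)%N -> uniq ((i, false) :: q').
  move=> q'P + le; case: (shortenP q'P) => p' p'P p'U p'sub p'l.
  have {}p'sub : {subset (i, false) :: p' <= (i, false) :: q'}.
    by move=> t; rewrite !inE => /predU1P[->|/p'sub ->]; rewrite ?eqxx ?orbT.
  apply: leq_size_uniq p'U p'sub _.
  by rewrite /= ltnS; apply: leq_trans le _; exact: qmin.
have qU := min_uniq q qP qj (leqnn _).
have qiK u : (u, false) \in (i, false) :: q -> u \notin K.
  by apply: (walk_not_in qP); rewrite qj.
(* The state [(i, false)] is not repeated. After [(i, true)] the ball can only go down, as [i] is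
   outside [K], and it could have done so from the start. *)
have iq t : t \in q -> t.1 != i.
  case: t => u d tq; apply: contraTneq isT => /= ui; rewrite {u}ui in tq.
  move: qU => /= /andP[iq _]; case: d tq => tq; last by rewrite tq in iq.
  case/splitPr: tq qP qj qmin {min_uniq iq qm qiK} => q1 q2.
  rewrite cat_path last_cat /= => /and3P[_ _ +] qj qmin.
  case: q2 qj qmin => [|u q2] qj qmin.
    by move=> _; have := qmin [::] isT; rewrite -qj => /(_ erefl); rewrite size_cat addnS.
  move=> /= /andP[iu uq2]; have := qmin (u :: q2).
  rewrite size_cat /= qj uq2 andbT => H.
  suff hs : ball_step G K (i, false) u by move: (H hs erefl); lia.
  by move: iu; rewrite /ball_step /= (negbTE iK); case: u.2; rewrite ?andbF.
case: q => [|[p1 d] q] in qm qP qj qmin min_uniq qU qiK iq *.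
  by apply: nlink; rewrite -qj; apply: linked_refl.
have ip1 : i != p1 by rewrite eq_sym (iq (p1, d)) ?mem_head.
have ij : i != j.
  by rewrite eq_sym -qj /= iq // mem_last.
have iq' t : t \in q -> t.1 != i by move=> tq; apply: iq; rewrite inE tq orbT.
move: qP => /= /andP[ip1G qP]; move: ip1G; rewrite /ball_step /= => /andP[].
case: d => [] in qm qP qj qmin min_uniq qU qiK iq *; move=> ip1G _; last first.
  apply: nlink; apply: linked_parent ip1G ip1 ij iK _.
  apply: (IH _ _ _ _ q) => //; first by apply: qiK; rewrite !inE eqxx orbT.
  apply: (sub_walk (P := predC1 i)) qP => // a b /= ai bi Gab.
  by apply/and3P; split.
(* The first step goes down to [p1]. If [p1] is in [K], the ball must go back up to some [p2], and
   [p1] is a collider between [i] and [p2]. *)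
case: (boolP (p1 \in K)) => p1K.
  case: q => [|[p2 d2] q] in qm qP qj qmin min_uniq qU qiK iq iq' *.
    by rewrite -qj /= p1K in jK.
  move: qP => /= /andP[st qP].
  case: d2 => [] in qm qP st qj qmin min_uniq qU qiK iq iq' *.
    by move: st; rewrite /ball_step /= p1K andbF.
  move: st; rewrite /ball_step /= p1K andbT => Gp2.
  have nq t : t \in (p2, false) :: q -> t.1 != p1.
    case: t => u d tq; apply: contraTneq isT => /= ui; rewrite {u}ui in tq.
    case: d tq => tq; first by move: qU => /= /and3P[_]; rewrite tq.
    by have := qiK p1; rewrite 2!inE tq !orbT p1K => /(_ isT).
  have nqi t : t \in (p2, false) :: q -> t.1 != i by exact: iq'.
  apply: nlink; apply: (@linked_collider G i j p1 p2) => //.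
  - by rewrite eq_sym (nqi (p2, false)) ?mem_head.
  - by rewrite eq_sym (nq (p2, false)) ?mem_head.
  - by apply: contraNneq jK => <-.
  - apply: (IH _ _ _ _ q) => //; first exact: ltnW.
    + by rewrite !inE negb_and qiK ?orbT // !inE eqxx !orbT.
    + by rewrite !inE negb_and jK orbT.
    + apply: (sub_walk (P := [pred v | (v != i) && (v != p1)])) qP => // [a b|a|t tq].
      * move=> /= /andP[ai ap] /andP[bi bp] Gab.
        by rewrite /del_nodes /= Gab !negb_or ai ap bi bp.
      * by move=> /= /andP[ai ap]; rewrite !inE ap.
      * by rewrite /= nq // nqi.
(* If the ball does not return to [p1], the rest of the walk uses no edge into [p1], and [p1] can be
   made a copy of [i]. *)
case: (boolP ((p1, false) \in q)) => p1q; last first.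
  have nq t : t \in q -> t.1 != p1.
    case: t => u d tq; apply: contraTneq isT => /= ui; rewrite {u}ui in tq.
    case: d tq => tq; last by rewrite tq in p1q.
    by move: qU => /= /and3P[_]; rewrite tq.
  apply: nlink; apply: (linked_child ip1G ip1 ij iK p1K).
  apply: (IH _ _ _ _ q) => //; last by rewrite -qj; case: (q).
  clear qm qj qmin min_uniq qU qiK iq p1q.
  case: q => [|t q] in qP nq iq' *; first by [].
  move: qP => /= /andP[st qP]; apply/andP; split.
    move: st; rewrite /ball_step /del_nodes /= (negbTE p1K) /=;
      case: t.2 (nq t) (iq' t) => /=;
      last by rewrite andbF.
    rewrite mem_head => /(_ isT) tp /(_ isT) ti; rewrite andbT => ->.
    by rewrite eq_sym ip1 ti tp.
  apply: (sub_walk (P := [pred v | (v != i) && (v != p1)])) qP => // [a b|u uq].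
    by move=> /= /andP[ai ap] /andP[bi bp] Gab; rewrite /del_nodes /= Gab ai bi bp.
  by rewrite /= nq // iq'.
have [q1 [q2 qE]] : exists q1 q2, q = rcons q1 (p1, false) ++ q2.
  by case/splitPr: p1q => q1 q2; exists q1, q2; rewrite cat_rcons.
rewrite {q}qE in qm qP qj qmin min_uniq qU qiK iq iq' p1q.
move: qP; rewrite cat_path last_rcons => /andP[q1P q2P].
(* The ball returns to [p1], which is thus an ancestor of [K]: let it go down
   to the nearest element of [K] and back instead. *)
have [m1 [m2 [d1 d2 le12]]] := walk_descent q1P (last_rcons _ _ _).
(* The smaller of the two descents, walked down and back, is no longer than the loop that it
   replaces. *)
have [d dd ld] : exists2 d, descent G K d p1 & (d.*2 <= size (rcons q1 (p1, false)))%N.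
  case/orP: (leq_total m1 m2) => lm; [exists m1 => //|exists m2 => //];
    by apply: leq_trans le12; rewrite -addnn ?leq_add2l ?leq_add2r.
pose dmin := ex_minn (ex_intro (fun d => descent G K d p1) d dd).
have [dmin_d dmin_le] : descent G K dmin p1 /\ forall d, descent G K d p1 -> (dmin <= d)%N.
  by rewrite /dmin; case: ex_minnP.
case: dmin => [|e] in dmin_d dmin_le; first by rewrite /= (negbTE p1K) in dmin_d.
have [|q3 [q3P q3l q3s [A [c [k [B [kK q3E]]]]]]] := bounce_walk dmin_d.
  by move=> m' m'e; apply/negP => /dmin_le; rewrite ltnNge m'e.
have qs : size ((p1, true) :: q3 ++ q2) = (size q3 + size q2).+1 by rewrite /= size_cat.
have qs' : (size ((p1, true) :: q3 ++ q2) <=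
            size ((p1, true) :: rcons q1 (p1, false) ++ q2))%N.
  rewrite /= !size_cat ltnS leq_add2r q3s; apply: leq_trans ld.
  by rewrite leq_double dmin_le.
have qP : path (ball_step G K) (i, false) ((p1, true) :: q3 ++ q2).
  by rewrite /= cat_path q3P q3l q2P /ball_step /= ip1G iK.
have {}qj : (last (i, false) ((p1, true) :: q3 ++ q2)).1 = j.
  by rewrite /= last_cat q3l -qj /= last_cat last_rcons.
have {min_uniq}qU := min_uniq _ qP qj qs'.
have {}qmin q' : path (ball_step G K) (i, false) q' -> (last (i, false) q').1 = j ->
    (size ((p1, true) :: q3 ++ q2) <= size q')%N.
  by move=> q'P q'j; apply: leq_trans qs' _; apply: qmin.
have {qs'}qm := leq_trans qs' qm.
have qE : (p1, true) :: q3 ++ q2 = A ++ [:: (c, true), (k, true), (c, false) & B ++ q2].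
  by rewrite -cat_cons q3E -catA.
rewrite {}qE in qm qP qj qU qmin.
move: (B ++ q2) qm qP qj qU qmin => {q3E}B qm qP qj qU qmin.
have {}qiK u :
    (u, false) \in (i, false) :: A ++ [:: (c, true), (k, true), (c, false) & B] ->
    u \notin K by apply: (walk_not_in qP); rewrite qj.
move: qP; rewrite cat_path /= => /and5P[AP lc ck _ BP].
have /andP[/= Gck cK] := ck.
(* A walk ending with the return to [c] could have stopped at [c] on the way down. *)
case: B BP => [|t B] BP in qm qj qU qmin qiK *.
  have := qmin (rcons A (c, true)).
  rewrite rcons_path AP lc last_rcons -qj last_cat => /(_ isT erefl).
  by rewrite size_cat size_rcons /=; move: (size A); clear; lia.
have /andP[ct tB] := BP.
(* If the walk went down from [c] after the bounce, it could have done so at its first visit, since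
   [c] is outside [K]. *)
have ct' : t.2 = false.
  apply: negbTE; apply/negP => t2; have := qmin (A ++ [:: (c, true), t & B]).
  have ct' : ball_step G K (c, true) t by move: ct; rewrite /ball_step /= t2.
  rewrite cat_path AP -qj !last_cat /= lc ct' (tB : path _ _ _) => /(_ isT erefl).
  by rewrite !size_cat /=; move: (size A) (size B); clear; lia.
have Gtc : G t.1 c by move: ct; rewrite /ball_step ct' => /andP[].
(* Both states of [c] and the state [(k, true)] are used up by the bounce, and [(k, false)] cannot
   occur because [k] is in [K]. *)
have [nA nB] : {in (i, false) :: A, forall u, (u.1 != c) && (u.1 != k)} /\
               {in t :: B, forall u, (u.1 != c) && (u.1 != k)}.
  move: qU; rewrite -cat_cons cat_uniq => /and3P[_ /hasPn nA].
  rewrite -[X in uniq X]/([:: (c, true); (k, true); (c, false)] ++ (t :: B)) cat_uniq.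
  case/and3P=> _ /hasPn nB _; split=> -[u b] /= uq; apply/andP; split.
  - apply: contraTneq uq => ->; apply: nA.
    by case: b; rewrite !inE eqxx ?orbT.
  - apply: contraTneq uq => ->; case: b; first by apply: nA; rewrite !inE eqxx orbT.
    by apply/negP => kA; move: (qiK k); rewrite -cat_cons mem_cat kA kK => /(_ isT).
  - apply: contraL (nB _ uq) => /eqP ->; rewrite negbK.
    by case: (b); rewrite !inE eqxx ?orbT.
  - case: b uq => uq; last first.
      apply/eqP => uk; rewrite uk in uq.
      have := qiK k; rewrite -cat_cons mem_cat.
      rewrite (in_cons (c, true)) (in_cons (k, true)) (in_cons (c, false)) uq !orbT kK.
      by move/(_ isT).
    by apply: contraL (nB _ uq) => /eqP ->; rewrite negbK !inE eqxx orbT.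
have /andP[ic ik] := nA (i, false) (mem_head _ _).
have /andP[jc jk] : (j != c) && (j != k).
  by rewrite -qj last_cat /=; apply: nB; apply: mem_last.
have ck' : c != k by apply: contraNneq cK => ->.
apply: nlink; apply: (linked_contract Gck ck' ik jk kK).
have sub s q : {in s :: q, forall u, (u.1 != c) && (u.1 != k)} ->
    path (ball_step G K) s q ->
    path (ball_step (del_nodes G (pred1 k)) (c |: K :\ k)) s q.
  move=> sq; apply: (sub_walk (P := [pred v | (v != c) && (v != k)])) => //.
    by move=> a b /= /andP[_ ak] /andP[_ bk] Gab; apply/and3P.
  by move=> a /= /andP[/negbTE ac /negbTE ak]; rewrite !inE ac ak.
have lA := nA _ (mem_last _ _).
(* With [c] conditioned on instead of [k], the ball turns at [c] itself, which saves two steps. *)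
apply: (IH _ _ _ _ (A ++ [:: (c, true), t & B])).
- by apply: leq_trans qm; rewrite !size_cat /= !addnS !ltnS.
- by rewrite !inE negb_or ic negb_and iK orbT.
- by rewrite !inE negb_or jc negb_and jK orbT.
- rewrite cat_path sub //=; apply/and3P; split.
  + case/andP: lA => lc' lk; move: lc; rewrite /ball_step /del_nodes /=.
    by rewrite !andbF !inE (negbTE lc') (negbTE lk) ck' /= ?andbT.
  + rewrite /ball_step ct' /= !inE eqxx /del_nodes /= Gtc ck' !andbT.
    by case/andP: (nB t (mem_head _ _)).
  + by apply: sub.
- by rewrite -qj !last_cat.
Qed.

End Complete.

(** * The models on subgraphs of a digraph *)

Section Models.
Variables (n : nat) (G : rel 'I_n).
Implicit Types (i j : 'I_n) (K : {set 'I_n}).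

(* The free nodes and the edges of a model. *)
Definition model : Type := ({set 'I_n} * {set 'I_n * 'I_n})%type.

Definition edge_rel (m : model) : rel 'I_n := fun a b => (a, b) \in m.2.

Definition submodels : seq model :=
  [seq m : model <- enum {: model} | m.2 \subset [set e | G e.1 e.2]].

Definition model_rank (m : model) : {set 'I_n} -> nat :=
  linear_rank (model_space 'F_2 m.1 (edge_rel m)).

Lemma model_rankP m : rank_function (model_rank m).
Proof. exact: linear_rank_function. Qed.

Lemma mem_submodels m : (m \in submodels) = `[< subrel (edge_rel m) G >].
Proof.
rewrite mem_filter mem_enum andbT; apply/fintype.subsetP/asboolP => sub.
  by move=> a b /sub; rewrite inE.
by case=> a b /sub; rewrite inE.
Qed.

Lemma model_rank_linked i j K : i \notin K -> linked G i j K ->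
  exists2 m, m \in submodels &
    (model_rank m (i |: (j |: K)) + model_rank m K
     < model_rank m (i |: K) + model_rank m (j |: K))%N.
Proof.
move=> iK [S [E [sEG fwd [x [xS xK x1]]]]].
pose m : model := (S, [set e | E e.1 e.2]).
have mE : edge_rel m = E by apply/funext => a; apply/funext => b; rewrite /edge_rel inE.
exists m; first by rewrite mem_submodels mE; apply/asboolP.
pose y := \row_v x v.
have yK : (y <= vanishing (model_space 'F_2 S E) K)%MS.
  apply/vanishingP; split=> [|v vK]; last by rewrite mxE xK.
  by apply/model_spaceP => v vS; rewrite mxE xS //; apply: eq_bigr => p _; rewrite mxE.
have xij := fwd x xS xK.
apply: (rank_ci_lt (model_rankP m)); rewrite /model_rank mE linear_rankU1.
- by apply/asboolPn => /(_ y yK)/eqP; rewrite mxE x1.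
- by apply/asboolPn => /(_ y yK)/eqP; rewrite mxE -xij x1.
- apply/asboolP => z /vanishingP[/model_spaceP zS zK].
  by rewrite (fwd (z 0)) ?zK ?setU11 // => v vK; rewrite zK // setU1r.
Qed.

(** If [i] and [j] were parallel non-loops over [K], some solution vanishing on [K] would be nonzero
    at [i]. Making it vanish at [j] without changing its value at [i] contradicts parallelism. *)
Lemma model_rank_sound m i j K : acyclic G -> m \in submodels ->
  i \notin K -> d_separated G i j K ->
  (model_rank m (i |: (j |: K)) + model_rank m K
   = model_rank m (i |: K) + model_rank m (j |: K))%N.
Proof.
rewrite mem_submodels => dagG /asboolP sEG iK sep.
apply: (rank_ci_eq (model_rankP m)) => -[+ _ rij].
rewrite [_ == _]linear_rankU1 => /asboolPn/existsNP[x].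
move=> /not_implyP[/vanishingP[/model_spaceP xS xK] xi].
move: rij; rewrite [_ == _]linear_rankU1 => /asboolP h.
have [y [yS yK yi yj]] := model_sound dagG sEG iK sep xS xK.
apply: xi; rewrite -yi -(h (\row_v y v)) ?mxE //.
apply/vanishingP; split=> [|v]; last by rewrite mxE => /setU1P[->|/yK].
by apply/model_spaceP => v vS; rewrite mxE yS //; apply: eq_bigr => p _; rewrite mxE.
Qed.

Lemma submodels_ciP i j K : acyclic G -> ci_wf i j K ->
  (\sum_(m <- submodels) model_rank m (i |: K)
   + \sum_(m <- submodels) model_rank m (j |: K)
   = \sum_(m <- submodels) model_rank m (i |: (j |: K))
     + \sum_(m <- submodels) model_rank m K)%N <-> dag_gaussoid G i j K.
Proof.
move=> dagG wf; have [_ iK jK] := wf.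
have submod m : (model_rank m (i |: (j |: K)) + model_rank m K
                 <= model_rank m (i |: K) + model_rank m (j |: K))%N.
  by apply: (rank_submod1 (model_rankP m)); apply: subsetUr.
apply: (iff_trans (eq_sum_leq submodels submod)); split=> [eq_m|[_ sep] m ms].
  split; first exact: wf.
  move=> sep; have [q qP qj] := (bayes_ball_walk dagG j iK).1 sep.
  have [m ms] := model_rank_linked iK (walk_linked iK jK qP qj).
  by rewrite ltn_neqAle => /andP[/eqP[]]; exact: eq_m.
exact: model_rank_sound.
Qed.

End Models.

(** * Normal fans of polytopes *)

Section Hulls.
Local Open Scope classical_set_scope.
Variables (R : realType) (n : nat).
Implicit Types (u w x y z : 'rV[R]_n) (P Q V : set 'rV[R]_n).

Lemma dotC u x : dot u x = dot x u.
Proof. by apply: eq_bigr => i _; rewrite mulrC. Qed.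

Lemma dotDr u x y : dot u (x + y) = dot u x + dot u y.
Proof. by rewrite -big_split; apply: eq_bigr => i _; rewrite mxE mulrDr. Qed.

Lemma dotZr u a x : dot u (a *: x) = a * dot u x.
Proof. by rewrite mulr_sumr; apply: eq_bigr => i _; rewrite mxE mulrCA. Qed.

Lemma dotNr u x : dot u (- x) = - dot u x.
Proof. by rewrite -scaleN1r dotZr mulN1r. Qed.

Lemma dotBr u x y : dot u (x - y) = dot u x - dot u y.
Proof. by rewrite dotDr dotNr. Qed.

Lemma dot0r u : dot u 0 = 0.
Proof. by rewrite -(scale0r 0) dotZr mul0r. Qed.

Lemma dotDl u w x : dot (u + w) x = dot u x + dot w x.
Proof. by rewrite dotC dotDr !(dotC x). Qed.

Lemma dotZl a u x : dot (a *: u) x = a * dot u x.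
Proof. by rewrite dotC dotZr (dotC x). Qed.

Lemma dotBl u w x : dot (u - w) x = dot u x - dot w x.
Proof. by rewrite dotC dotBr !(dotC x). Qed.

Lemma dot_sumr (I : Type) (s : seq I) (p : pred I) u (F : I -> 'rV[R]_n) :
  dot u (\sum_(i <- s | p i) F i) = \sum_(i <- s | p i) dot u (F i).
Proof.
by elim/big_rec2: _ => [|i a b _ <-]; rewrite ?dot0r ?dotDr.
Qed.

Lemma dot_inj x y : (forall u, dot u x = dot u y) -> x = y.
Proof.
have dot_delta i z : dot (delta_mx 0 i) z = z 0 i.
  rewrite /dot (bigD1 i) //= mxE !eqxx mul1r big1 ?addr0 // => k /negbTE ki.
  by rewrite mxE ki mul0r.
by move=> xy; apply/rowP => i; rewrite -!dot_delta.
Qed.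

Definition stable_conv Q : Prop := forall x y t, 0 <= t <= 1 -> Q x -> Q y ->
  Q (t *: x + (1 - t) *: y).

Lemma convex_setE Q : @convex_set R 'rV[R]_n Q <-> stable_conv Q.
Proof.
split=> cQ x y t.
  case/andP=> t0 t1 Qx Qy.
  have := cQ x y (Itv01 t0 t1); rewrite !in_setE => /(_ Qx Qy).
  by [].
rewrite !in_setE => Qx Qy; apply: (cQ x y t%:num) => //.
by rewrite ge0 le1.
Qed.

Lemma hull_sub V Q : stable_conv Q -> V `<=` Q -> convex_hull V `<=` Q.
Proof. by move/convex_setE; apply: smallest_sub. Qed.

Lemma hull_gen V : V `<=` convex_hull V.
Proof. exact: sub_gen_smallest. Qed.

Lemma hull_conv V : stable_conv (convex_hull V).
Proof.
move=> x y t t01 Vx Vy Q [cQ VQ]; have /convex_setE := cQ; apply=> //.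
  exact: Vx.
exact: Vy.
Qed.

Lemma hull_dot_le V u c : (forall v, V v -> dot u v <= c) ->
  forall y, convex_hull V y -> dot u y <= c.
Proof.
move=> Vc y; apply: (hull_sub (Q := [set y | dot u y <= c])) => //
  x z t /andP[t0 t1] /= xc zc.
by rewrite dotDr !dotZr; nra.
Qed.

(** With one summand fixed, the condition on the other is convex, so it is enough to check
    generators, first in [V] and then in [W]. *)
Lemma hull_minkowski V W :
  minkowski_sum (convex_hull V) (convex_hull W)
  = convex_hull [set v + w | v in V & w in W].
Proof.
apply/seteqP; split=> [x [y [z [Vy Wz ->]]]|].
  move: y Vy; apply: hull_sub => [y y' t t01 /= H H'|v Vv /=].
    have -> : t *: y + (1 - t) *: y' + z = t *: (y + z) + (1 - t) *: (y' + z).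
      rewrite !scalerDr addrACA -[t *: z + _]scalerDl (_ : t + (1 - t) = 1) ?scale1r //.
      by rewrite addrC subrK.
    exact: hull_conv.
  move: z Wz; apply: hull_sub => [z z' t t01 /= H H'|w Ww /=].
    have -> : v + (t *: z + (1 - t) *: z') = t *: (v + z) + (1 - t) *: (v + z').
      rewrite !scalerDr addrACA -[t *: v + _]scalerDl (_ : t + (1 - t) = 1) ?scale1r //.
      by rewrite addrC subrK.
    exact: hull_conv.
  by apply: hull_gen; exists v => //; exists w.
apply: hull_sub => [_ _ t t01 [y [z [Vy Wz ->]]] [y' [z' [Vy' Wz' ->]]]|_ [v Vv [w Ww <-]]].
  exists (t *: y + (1 - t) *: y'), (t *: z + (1 - t) *: z').
  by split; [exact: hull_conv|exact: hull_conv|rewrite !scalerDr addrACA].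
by exists v, w; split=> //; apply: hull_gen.
Qed.

(** A proper convex combination reaches the maximum of [w] only if both endpoints do. Hence the set
    [Q], whose last condition concerns only such maximizers, is convex and contains the hull once it
    contains [V]. *)
Lemma argmax_hull V w u :
  (forall v, V v -> argmax w (convex_hull V) v -> argmax u (convex_hull V) v) ->
  argmax w (convex_hull V) `<=` argmax u (convex_hull V).
Proof.
move=> Vu x [Vx wx]; split=> //.
pose Q := [set y | [/\ convex_hull V y, dot w y <= dot w x &
  dot w y = dot w x -> forall z, convex_hull V z -> dot u z <= dot u y]].
suff [_ _] : Q x by apply.
move: Vx; apply: hull_sub => [y z t t01 [Vy wy uy] [Vz wz uz]|v Vv].
  split; first exact: hull_conv.
    by move: t01 => /andP[t0 t1]; rewrite dotDr !dotZr; nra.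
  have [->|t0] := eqVneq t 0; first by rewrite scale0r add0r subr0 scale1r.
  have [->|t1] := eqVneq t 1; first by rewrite subrr scale0r addr0 scale1r.
  move: t01; rewrite [_ <= t]le_eqVlt [t <= _]le_eqVlt eq_sym (negbTE t0) (negbTE t1) /=.
  case/andP=> {}t0 {}t1; rewrite !dotDr !dotZr => eq_w.
  have yE : dot w y = dot w x by nra.
  have zE : dot w z = dot w x by nra.
  move=> z' Vz'; have := uy yE z' Vz'; have := uz zE z' Vz'; nra.
have Vv' := hull_gen Vv; split=> //; first exact: wx.
by move=> vE; case: (Vu v Vv) => //; split=> // z Vz; rewrite vE wx.
Qed.

(** Normal cones of points of the polytope that cover the space already determine the normal fan:
    the normal cones of all faces are the faces of these cones. *)
Lemma normal_fan_hull (J : Type) V (x : J -> 'rV[R]_n) (C : J -> set 'rV[R]_n) :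
  finite_set V -> (forall s, convex_hull V (x s)) ->
  (forall s, C s = [set u | argmax u (convex_hull V) (x s)]) ->
  (forall u, exists s, C s u) ->
  normal_fan (convex_hull V) = [set F | exists s, faces (C s) F].
Proof.
move=> /finite_seqP[sV VE] Vx CE cover; set P := convex_hull V.
have C0 s : C s 0 by rewrite CE; split=> // y _; rewrite !(dotC 0) !dot0r.
have Cmem s u : C s u <-> forall y, P y -> dot u y <= dot u (x s).
  by rewrite CE; split=> [[]|].
have CV s u : (forall v, v \in sV -> dot u v <= dot u (x s)) -> C s u.
  move=> h; apply/Cmem => y; apply: hull_dot_le => v; rewrite VE; exact: h.
have PV v : v \in sV -> P v by move=> vV; apply: hull_gen; rewrite VE.
apply/seteqP; split=> [N [F [F0 [w FE]] <-]|N [s [[u0 u0N] [z NE]]]].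
- have [s Csw] := cover w; exists s.
  have Fx : F (x s) by rewrite FE; rewrite CE in Csw.
  (* Each summand is nonpositive on [C s], so [z] is maximal exactly where all generators in [F] tie
     with [x s]; this exposes the normal cone of [F]. *)
  pose z := \sum_(v <- sV | `[< F v >]) (v - x s).
  have zE u : dot z u = \sum_(v <- sV | `[< F v >]) dot u (v - x s).
    by rewrite dotC dot_sumr.
  have z_le u v : C s u -> v \in sV -> dot u (v - x s) <= 0.
    by move=> /Cmem Csu vV; rewrite dotBr subr_le0; apply: Csu; apply: PV.
  split; first by exists w; rewrite /normal_cone FE.
  exists z; apply/seteqP; split=> u.
    move=> NFu; have [_ umax] := NFu _ Fx.
    have Csu : C s u by apply/Cmem.
    split=> // y Csy.
    have -> : dot z u = 0.
      rewrite zE big1 // => v /asboolP Fv; have [Pv vmax] := NFu _ Fv.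
      by apply/eqP; rewrite dotBr subr_eq0 eq_le umax ?(vmax _ (Vx s)).
    rewrite zE big_seq_cond; apply: sumr_le0 => v /andP[vV _]; exact: z_le.
  move=> [Csu umax]; rewrite /normal_cone /= FE; apply: argmax_hull => v Vv wv.
  have vV : v \in sV by move: Vv; rewrite VE.
  have Pv := PV v vV; split=> // y Py.
  have := umax 0 (C0 s); rewrite dot0r zE -oppr_le0 -sumrN => le0.
  have : \sum_(v <- sV | `[< F v >]) - dot u (v - x s) == 0.
    rewrite eq_le le0 big_seq_cond sumr_ge0 // => v' /andP[v'V _].
    by rewrite oppr_ge0 z_le.
  rewrite big_seq_cond psumr_eq0; last first.
    by move=> v' /andP[v'V _]; rewrite oppr_ge0 z_le.
  move=> /allP/(_ v vV); rewrite vV /=.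
  have -> : `[< F v >] by apply/asboolP; rewrite FE.
  rewrite /= oppr_eq0 dotBr subr_eq0 => /eqP ->.
  by move/Cmem: Csu; apply.
- have N_C u : N u -> C s u by rewrite NE => -[].
  have Cadd u u' : C s u -> C s u' -> C s (u + u').
    move=> /Cmem Cu /Cmem Cu'; apply/Cmem => y Py; rewrite !dotDl lerD ?Cu ?Cu' //.
  (* The maximum of a functional on a cone is 0: compare [u0] with 0 and with [u0 + u0]. *)
  have z0 : dot z u0 = 0.
    move: u0N; rewrite NE => -[Cu0 max0]; apply/eqP; rewrite eq_le.
    have := max0 _ (C0 s); rewrite dot0r => ->.
    by have := max0 _ (Cadd _ _ Cu0 Cu0); rewrite dotDr; lra.
  have z_le u : C s u -> dot z u <= 0.
    by move: u0N; rewrite NE -z0 => -[_]; apply.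
  have N_iff u : N u <-> C s u /\ dot z u = 0.
    rewrite NE; split=> [[Csu umax]|[Csu zu]].
      split=> //; apply/eqP; rewrite eq_le z_le //=.
      by have := umax _ (C0 s); rewrite dot0r.
    by split=> // y /z_le; rewrite zu.
  have Nadd u u' : N u -> N u' -> N (u + u').
    move=> /N_iff[Cu zu] /N_iff[Cu' zu']; apply/N_iff; split; first exact: Cadd.
    by rewrite dotDr zu zu' addr0.
  (* A point in the relative interior of [N]. *)
  have [us Nus us_lt] : exists2 us, N us & forall v u, v \in sV -> N u ->
      dot u v < dot u (x s) -> dot us v < dot us (x s).
    have : {subset sV <= sV} by [].
    elim: {1 3}sV => [|v l IH] sub; first by exists u0.
    have [u1 Nu1 u1lt] := IH (fun v' v'l => sub v' (mem_behead (s := v :: l) v'l)).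
    have [[u2 [Nu2 u2v]]|none] := pselect (exists u, N u /\ dot u v < dot u (x s)).
      exists (u1 + u2); first exact: Nadd.
      move=> v' u; rewrite inE !dotDl => /predU1P[-> _ _|v'l Nu uv'].
        have /N_C/Cmem /(_ _ (PV _ (sub _ (mem_head _ _)))) := Nu1.
        lra.
      have := u1lt v' u v'l Nu uv'.
      have /N_C/Cmem /(_ _ (PV v' (sub v' _))) := Nu2.
      rewrite inE v'l orbT => /(_ isT); lra.
    exists u1 => // v' u; rewrite inE => /predU1P[-> Nu uv|]; last exact: u1lt.
    by exfalso; apply: none; exists u.
  exists (argmax us P).
    by split; [exists (x s); have := N_C _ Nus; rewrite CE|exists us].
  apply/seteqP; split=> u.
    move=> Fu; have Csu : C s u by rewrite CE; apply: Fu; have := N_C _ Nus; rewrite CE.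
    have /Cmem Csus := N_C _ Nus; have /Cmem Csu' := Csu.
    apply/N_iff; split=> //; apply/eqP; rewrite eq_le z_le //=.
    (* For small [e] the point [us - e *: u] stays in [C s]. Since [z] vanishes at [us] and is
       nonpositive there, it is nonnegative at [u]. *)
    have [e e0 eV] : exists2 e, 0 < e &
        forall v, v \in sV -> e * dot u (x s - v) <= dot us (x s - v).
      have : {subset sV <= sV} by [].
      elim: {1 3}sV => [|v l IH] sub; first by exists 1.
      have [e1 e10 e1V] := IH (fun v' v'l => sub v' (mem_behead (s := v :: l) v'l)).
      have Pv := PV _ (sub _ (mem_head v l)).
      have [vE|v_ne] := eqVneq (dot us v) (dot us (x s)).
        exists e1 => // v'; rewrite inE => /predU1P[->|]; last exact: e1V.
        have [_ /(_ (x s) (Vx s))] : argmax u P v.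
          by apply: Fu; split=> // y Py; rewrite vE Csus.
        have := Csu' _ Pv; rewrite !dotBr vE; nra.
      have a0 : 0 < dot us (x s - v) by rewrite dotBr subr_gt0 lt_neqAle v_ne Csus.
      have b0 : 0 <= dot u (x s - v) by rewrite dotBr subr_ge0 Csu'.
      (* Adding 1 keeps the denominator positive even if [u] ties at [v] and [x s]. *)
      exists (Num.min e1 (dot us (x s - v) / (dot u (x s - v) + 1))).
        by rewrite lt_min e10 divr_gt0 //; lra.
      move=> v'; rewrite inE => /predU1P[->|v'l].
        apply: le_trans (_ : dot us (x s - v) / (dot u (x s - v) + 1) * dot u (x s - v) <= _).
          by rewrite ler_wpM2r // ge_min lexx orbT.
        rewrite mulrAC ler_pdivrMr; last by lra.
        by rewrite ler_wpM2l ?ltW //; lra.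
      apply: le_trans (e1V v' v'l); rewrite ler_wpM2r ?ge_min ?lexx //.
      by rewrite dotBr subr_ge0; apply: Csu'; apply: PV; apply: sub; rewrite inE v'l orbT.
    have /z_le : C s (us - e *: u).
      apply: CV => v vV; have := eV v vV; rewrite !dotBl !dotZl !dotBr; lra.
    move: (Nus) => /N_iff[_ zus]; rewrite dotBr dotZr zus; nra.
  move=> Nu; apply: argmax_hull => v Vv [Pv vmax].
  have vV : v \in sV by move: Vv; rewrite VE.
  split=> // y Py; have /Cmem/(_ y Py) := N_C _ Nu.
  case: (ltP (dot u v) (dot u (x s))) => [uv|vu xu]; last exact: le_trans xu vu.
  by have := us_lt v u vV Nu uv; rewrite ltNge vmax.
Qed.

End Hulls.

(** * Greedy vertices *)

Section Sorting.
Local Open Scope classical_set_scope.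
Variables (R : realType) (n : nat).
Implicit Types (u x : 'rV[R]_n) (s t : 'S_n).

Lemma perm_coneP s u :
  (forall k l : 'I_n, l = k.+1 :> nat -> u 0 (s l) <= u 0 (s k)) <-> perm_cone s u.
Proof.
split=> [adj k l|cone k l kl]; last by apply: cone; rewrite kl.
have [m] := ubnP (l - k); elim: m l => // m IH l lm kl.
have [->//|kl'] := eqVneq l k.
have lt : (k < l)%N by rewrite ltn_neqAle kl andbT eq_sym.
have pl : (l.-1 < n)%N by apply: leq_ltn_trans (leq_pred l) _.
apply: le_trans (adj (Ordinal pl) l _) (IH _ _ _) => /=; lia.
Qed.

Lemma sumB_differ2 (k l : 'I_n) (F G : 'I_n -> R) : k != l ->
  (forall m, m != k -> m != l -> F m = G m) ->
  \sum_m F m - \sum_m G m = F k + F l - (G k + G l).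
Proof.
move=> kl FG; rewrite (bigD1 k) // (bigD1 l) 1?eq_sym //=.
rewrite [X in _ - X](bigD1 k) // [X in _ - (_ + X)](bigD1 l) 1?eq_sym //=.
rewrite (eq_bigr G) => [|m /andP[mk ml]]; last exact: FG.
lra.
Qed.

(* Bubble sort: a permutation in [Q] that maximizes [- \sum_k k u(s k)] is
   sorted. *)
Lemma bubble_sort (Q : pred 'S_n) u s0 : Q s0 ->
  (forall s (k l : 'I_n), Q s -> l = k.+1 :> nat -> u 0 (s k) < u 0 (s l) ->
     Q (tperm k l * s)%g) ->
  exists2 s, Q s & perm_cone s u.
Proof.
move=> Qs0 Qswap; pose pot s : R := \sum_(k < n) (k%:R * - u 0 (s k)).
have [s Qs smax] := @arg_maxP _ _ _ s0 Q pot Qs0.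
exists s => //; apply/perm_coneP => k l lk; rewrite leNgt; apply/negP => ukl.
have := smax _ (Qswap s k l Qs lk ukl); rewrite /= leNgt => /negP; apply.
have kl : k != l by rewrite -val_eqE /= lk neq_ltn leqnn.
rewrite -subr_gt0 (sumB_differ2 kl) // => [|m mk ml]; last first.
  by rewrite permM tpermD // eq_sym.
rewrite !permM tpermL tpermR lk -[k.+1%:R]natr1; lra.
Qed.

Lemma perm_cone_exists u : exists s, perm_cone s u.
Proof.
have [s _ su] := @bubble_sort predT u 1%g isT (fun _ _ _ _ _ _ => isT).
by exists s.
Qed.

(** Summation by parts. The constant [c] is there for the induction, which takes the last weight
    [a ord_max] as the lower bound for the shorter sum. *)
Lemma abel_sum (m : nat) (a : 'I_m -> R) (d : nat -> R) (c : R) :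
  (forall k l : 'I_m, (k <= l)%N -> a l <= a k) -> (forall k, c <= a k) ->
  d 0%N = 0 -> (forall k, (k <= m)%N -> 0 <= d k) ->
  c * d m <= \sum_(k < m) a k * (d k.+1 - d k).
Proof.
elim: m a c => [|m IH] a c decr ca d0 d_ge; first by rewrite d0 mulr0 big_ord0.
rewrite big_ord_recr /=.
have IHm : a ord_max * d m <=
    \sum_(k < m) a (widen_ord (leqnSn m) k) * (d k.+1 - d k).
  apply: IH => // [k l kl|k|k km]; first exact: decr.
    by apply: decr; rewrite /= ltnW.
  by apply: d_ge; apply: leqW.
apply: le_trans (_ : a ord_max * d m.+1 <= _); first by rewrite ler_wpM2r ?d_ge.
have -> : a ord_max * d m.+1 = a ord_max * d m + a ord_max * (d m.+1 - d m).
  by rewrite -mulrDr addrC subrK.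
by rewrite lerD2r.
Qed.

End Sorting.

Section GreedyVertices.
Local Open Scope classical_set_scope.
Variables (R : realType) (n : nat) (I : eqType) (r : I -> {set 'I_n} -> nat).
Hypothesis rP : forall m, rank_function (r m).
Implicit Types (u x : 'rV[R]_n) (s t : 'S_n) (l : seq I) (f : {set 'I_n} -> nat).

(** The increments of [f] along the chain of prefixes of [s], placed at the elements added. The
    formula is additive in [f], so it also serves sums of rank functions. *)
Definition greedy_vertex f s : 'rV[R]_n :=
  \row_v ((f (prefix_set s ((s^-1)%g v).+1))%:R - (f (prefix_set s ((s^-1)%g v)))%:R).

Lemma dot_greedy_vertex f s u : dot u (greedy_vertex f s) =
  \sum_(k < n) u 0 (s k) * ((f (prefix_set s k.+1))%:R - (f (prefix_set s k))%:R).
Proof.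
rewrite /dot (reindex_inj (@perm_inj _ s)); apply: eq_bigr => k _.
by rewrite mxE permK.
Qed.

Lemma indicator_greedy m s :
  indicator R (greedy_basis (r m) s) = greedy_vertex (r m) s.
Proof.
apply/rowP => v; rewrite !mxE inE; set k := (s^-1)%g v.
have := rankS (rP m) (prefix_set s k) (s k); rewrite -prefixS.
case: eqVneq => [->|]; first by rewrite subrr.
move=> ne /andP[le1 le2]; rewrite (_ : r m (prefix_set s k.+1) = (r m (prefix_set s k)).+1).
  by rewrite -natr1 addrC addKr.
by apply/eqP; rewrite eqn_leq le2 ltn_neqAle le1 eq_sym ne.
Qed.

Lemma matroid_polytope_greedy m s :
  matroid_polytope (R := R) (rank_matroid (rP m)) (greedy_vertex (r m) s).
Proof.
apply: hull_gen; rewrite -indicator_greedy.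
by exists (greedy_basis (r m) s) => //=; apply: greedy_basis_in.
Qed.

(** Optimality of the greedy algorithm: on every prefix a basis has at most as many elements as the
    rank, with equality on the whole set, and summation by parts against decreasing weights compares
    the two values. *)
Lemma matroid_polytope_greedy_max m s u y : perm_cone s u ->
  matroid_polytope (R := R) (rank_matroid (rP m)) y ->
  dot u y <= dot u (greedy_vertex (r m) s).
Proof.
move=> su; apply: hull_dot_le => _ [B /= + <-]; rewrite inE => /andP[/eqP rB /eqP rT].
pose g k := #|B :&: prefix_set s k|.
(* Written in the same form, both vectors have a difference to which summation by parts applies. *)
have -> : indicator R B = greedy_vertex (fun A => #|B :&: A|) s.
  apply/rowP => v; rewrite !mxE; set k := (s^-1)%g v.
  have vk : v = s k by rewrite permKV.
  rewrite prefixS -vk setIUr.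
  case: (boolP (v \in B)) => vB.
    rewrite (setIidPr _) ?sub1set // cardsU1 !inE vB /= vk mem_prefix ltnn.
    by rewrite natrD addrK.
  rewrite (_ : B :&: [set v] = set0) ?set0U ?subrr //.
  by apply/disjoint_setI0; rewrite disjoint_sym disjoints1.
rewrite !dot_greedy_vertex -subr_ge0 -sumrB.
pose d k : R := (r m (prefix_set s k))%:R - #|B :&: prefix_set s k|%:R.
have d0 : d 0%N = 0 by rewrite /d prefix0 setI0 cards0 (rank0 (rP m)) subrr.
have dn : d n = 0 by rewrite /d prefixT setIT -rB rT subrr.
have d_ge k : 0 <= d k.
  rewrite subr_ge0 ler_nat; set A := prefix_set s k.
  apply: leq_trans (rank_le (rP m) (subsetIr B A)).
  have := rank_submod (rP m) (B :&: A) (B :\: A); rewrite setID rB => le_B.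
  rewrite -(leq_add2r #|B :\: A|) cardsID.
  apply: leq_trans (leq_trans (leq_addr _ _) le_B) _.
  by rewrite leq_add2l; apply: rank_card.
(* Any lower bound for the weights will do, as it gets multiplied by [d n = 0]. *)
have [c cu] : exists c, forall k, c <= u 0 (s k).
  exists (- \sum_k `|u 0 (s k)|) => k; rewrite (bigD1 k) //= opprD.
  apply: le_trans (_ : - `|u 0 (s k)| <= _); last by rewrite lerNl -normrN ler_norm.
  by rewrite gerDl oppr_le0 sumr_ge0.
have := abel_sum (a := fun k => u 0 (s k)) su cu d0 (fun k _ => d_ge k).
rewrite dn mulr0 => /le_trans; apply; apply: ler_sum => k _.
by rewrite /d -mulrBr; lra.
Qed.

Section Sum.
Variable l : seq I.

Definition sum_rank (A : {set 'I_n}) : nat := (\sum_(m <- l) r m A)%N.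

Lemma sum_rank_submod (K : {set 'I_n}) (i j : 'I_n) :
  (sum_rank (i |: (j |: K)) + sum_rank K <= sum_rank (i |: K) + sum_rank (j |: K))%N.
Proof.
rewrite /sum_rank -!big_split; apply: leq_sum => m _.
by apply: (rank_submod1 (rP m)); apply: subsetUr.
Qed.

Lemma greedy_vertex_sum s :
  greedy_vertex sum_rank s = \sum_(m <- l) greedy_vertex (r m) s.
Proof.
apply/rowP => v; rewrite summxE mxE !natr_sum -sumrB.
by apply: eq_bigr => m _; rewrite mxE.
Qed.

Definition rank_polytope : set 'rV[R]_n :=
  sum_matroid_polytopes [seq rank_matroid (rP m) | m <- l].

Lemma rank_polytope_greedy s : rank_polytope (greedy_vertex sum_rank s).
Proof.
rewrite greedy_vertex_sum /rank_polytope /sum_matroid_polytopes big_map.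
elim: l => [|m l' IH]; first by rewrite !big_nil.
rewrite !big_cons.
exists (greedy_vertex (r m) s), (\sum_(m' <- l') greedy_vertex (r m') s).
by split=> //; apply: matroid_polytope_greedy.
Qed.

Lemma rank_polytope_greedy_max s u y : perm_cone s u -> rank_polytope y ->
  dot u y <= dot u (greedy_vertex sum_rank s).
Proof.
move=> su; rewrite greedy_vertex_sum /rank_polytope /sum_matroid_polytopes big_map.
elim: l y => [|m l' IH] y; first by rewrite !big_nil => ->.
rewrite !big_cons => -[y1 [y2 [My1 Py2 ->]]]; rewrite !dotDr lerD ?IH //.
exact: matroid_polytope_greedy_max My1.
Qed.

Lemma prefix_set_swap s (k k' : 'I_n) (q : nat) : k' = k.+1 :> nat -> q <> k' ->
  prefix_set (tperm k k' * s)%g q = prefix_set s q.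
Proof.
move=> kk' qk'; apply/setP => v; rewrite -[v](permKV s) mem_prefix.
set x := (s^-1)%g v.
have -> : s x = (tperm k k' * s)%g (tperm k k' x) by rewrite permM tpermK.
rewrite mem_prefix; move: qk'.
by case: tpermP => [->|->|//]; move: kk'; clear; lia.
Qed.

(** The swap changes only the prefix of size [k.+1], so the change in value is the gap between the
    two weights times the submodularity defect at the wall. *)
Lemma dot_greedy_swap (g : {set 'I_n} -> nat) s u (k k' : 'I_n) : k' = k.+1 :> nat ->
  let K := prefix_set s k in
  dot u (greedy_vertex g (tperm k k' * s)%g) - dot u (greedy_vertex g s) =
  (u 0 (s k') - u 0 (s k)) *
  ((g (s k |: K) + g (s k' |: K))%N%:R - (g (s k |: (s k' |: K)) + g K)%N%:R).
Proof.
move=> kk' K; have ne : k != k' by rewrite -val_eqE /= kk' neq_ltn leqnn.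
rewrite !dot_greedy_vertex (sumB_differ2 ne) => [|m mk mk']; last first.
  rewrite permM tpermD 1?eq_sym // !prefix_set_swap //.
    by move/eqP; apply/negP; rewrite -val_eqE in mk'.
  by rewrite kk' => -[] /eqP; apply/negP; rewrite -val_eqE in mk.
rewrite !permM tpermL tpermR -kk' (@prefix_set_swap s k k' k) //; last by rewrite kk'; lia.
rewrite (@prefix_set_swap s k k' k'.+1) //; last lia.
have -> : prefix_set (tperm k k' * s)%g k' = s k' |: K.
  rewrite {1}kk' prefixS permM tpermL prefix_set_swap // kk'; lia.
have -> : prefix_set s k'.+1 = s k |: (s k' |: K).
  by rewrite prefixS kk' prefixS setUCA.
rewrite (_ : prefix_set s k' = s k |: K) ?kk' ?prefixS // !natrD; ring.
Qed.

Section CoarseCone.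
Variable A : ci_set n.
Hypothesis A_wf : forall i j K, A i j K -> ci_wf i j K.
Hypothesis A_ciP : forall i j K, ci_wf i j K ->
  (sum_rank (i |: K) + sum_rank (j |: K) = sum_rank (i |: (j |: K)) + sum_rank K)%N
  <-> A i j K.

Lemma removed_wall_vertex s t : removed_wall A s t ->
  greedy_vertex sum_rank t = greedy_vertex sum_rank s.
Proof.
case=> k [k' [kk' tE wall]].
have -> : t = (tperm k k' * s)%g by apply/permP => x; rewrite tE permM.
apply: dot_inj => u; apply/eqP; rewrite -subr_eq0 dot_greedy_swap //.
by rewrite (A_ciP (A_wf wall)).2 // subrr mulr0.
Qed.

(** The vertex is constant across removed walls and maximizes on each cone of the class. Conversely,
    sorting [s] by the weights of a functional [u] maximal at the vertex stays in the class: a swap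
    crossing a wall with positive defect would increase the value. *)
Lemma coarse_cone_greedy s :
  coarse_cone A s = [set u | argmax u rank_polytope (greedy_vertex sum_rank s)].
Proof.
pose step : rel 'S_n := fun a b => `[< removed_wall A a b >].
have connectE t : connect step s t ->
    greedy_vertex sum_rank t = greedy_vertex sum_rank s.
  case/connectP=> p + ->; elim: p s => //= a p IH s' /andP[/asboolP wall pP].
  by rewrite IH //; apply: removed_wall_vertex.
apply/seteqP; split=> u.
  case=> t /= /connectE <- tu; split; first exact: rank_polytope_greedy.
  by move=> y; apply: rank_polytope_greedy_max.
move=> /= [_ smax].
have [||t st tu] := @bubble_sort R n (connect step s) u s; last by exists t.
  exact: connect0.
move=> t k k' st kk' uk; apply: (connect_trans st); apply: connect1; apply/asboolP.
exists k, k'; split=> // [x|]; first by rewrite permM.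
have kt : t k \notin prefix_set t k by rewrite mem_prefix ltnn.
have k't : t k' \notin prefix_set t k by rewrite mem_prefix kk' -leqNgt leqnSn.
have ne : t k != t k' by rewrite (inj_eq perm_inj) -val_eqE /= kk' neq_ltn leqnn.
apply/A_ciP; first by split.
have := smax _ (rank_polytope_greedy (tperm k k' * t)%g).
rewrite -(connectE t st) -subr_le0 dot_greedy_swap // pmulr_rle0 ?subr_gt0 //.
rewrite subr_le0 ler_nat => le1; apply/eqP; rewrite eqn_leq le1.
exact: sum_rank_submod.
Qed.

End CoarseCone.

End Sum.

End GreedyVertices.

(** * From rank sums to the polytope and the semigraphoid *)

Lemma polytope_sum (R : realType) n (Ms : seq (matroid n)) :
  polytope (sum_matroid_polytopes (R := R) Ms).
Proof.
rewrite /sum_matroid_polytopes; elim: Ms => [|M Ms [V finV PE]].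
  rewrite big_nil; exists [set 0%R]%classic; first exact: finite_set1.
  apply/seteqP; split; first exact: hull_gen.
  apply: hull_sub => // x y t _ /= -> ->; rewrite !scaler0 addr0 //.
rewrite big_cons PE hull_minkowski; eexists; last by [].
apply: finite_image2 => //; apply: finite_image; exact: finite_finset.
Qed.

Lemma rank_submodular_semigraphoid (R : realType) n (f : {set 'I_n} -> nat)
    (A : ci_set n) :
  f set0 = 0%N ->
  (forall K i j, (f (i |: (j |: K)) + f K <= f (i |: K) + f (j |: K))%N) ->
  (forall i j K, A i j K -> ci_wf i j K) ->
  (forall i j K, ci_wf i j K ->
    (f (i |: K) + f (j |: K) = f (i |: (j |: K)) + f K)%N <-> A i j K) ->
  submodular_semigraphoid R A.
Proof.
move=> f0 f_submod A_wf A_ciP; split; last first.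
  exists (fun K => (f K)%:R); split=> [K i j _ _||i j K wf].
  + by rewrite -!natrD ler_nat.
  + by rewrite f0.
  + rewrite -!natrD; apply: iff_trans (A_ciP _ _ _ wf).
    by split=> [/eqP|->//]; rewrite eqr_nat => /eqP.
split=> // [i j L AL|i j k L].
  have [ij iL jL] := A_wf _ _ _ AL; apply/A_ciP; first by rewrite /ci_wf eq_sym.
  by rewrite addnC setUCA (A_ciP _ _ _ (A_wf _ _ _ AL)).2.
rewrite /= !inE negb_or andbT => /andP[/andP[ij ik] jk] iL jL kL Aij Aik.
have := (A_ciP _ _ _ (A_wf _ _ _ Aij)).2 Aij.
have := (A_ciP _ _ _ (A_wf _ _ _ Aik)).2 Aik.
have := f_submod L i k; have := f_submod (k |: L) i j.
have kjL : k |: (j |: L) = j |: (k |: L) by rewrite setUCA.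
(* The two given equalities add up to the sum of the two submodular inequalities with equality, so
   both are tight. *)
suff imp : forall a b c d e g h o : nat,
    (h + g <= d + e)%N -> (d + o <= a + g)%N -> (c + e = h + b)%N -> (a + b = c + o)%N ->
    (a + g = d + o)%N /\ (d + e = h + g)%N.
  rewrite kjL => le1 le2 eq1 eq2.
  have [eqk eqj] := imp _ _ _ _ _ _ _ _ le1 le2 eq1 eq2.
  by split; apply/A_ciP => //; split; rewrite // !inE negb_or ?ij ?jk ?ik.
by clear; move=> *; split; lia.
Qed.

Theorem theorem3p2 (R : realType) (n : nat) (G : rel 'I_n) (dagG : acyclic G) :
  submodular_semigraphoid R (dag_gaussoid G) /\
  exists P : classical_sets.set 'rV[R]_n,
    [/\ polytope P,
        normal_fan P = coarsening (dag_gaussoid G) &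
        exists Ms : seq (matroid n), P = sum_matroid_polytopes Ms].
Proof.
pose f := sum_rank (@model_rank n) (submodels G).
have f_submod := sum_rank_submod (@model_rankP n) (submodels G).
have A_wf i j K : dag_gaussoid G i j K -> ci_wf i j K by case.
have A_ciP i j K : ci_wf i j K ->
    (f (i |: K) + f (j |: K) = f (i |: (j |: K)) + f K)%N <-> dag_gaussoid G i j K.
  exact: submodels_ciP.
have rank_0 : f set0 = 0%N by rewrite /f /sum_rank big1 // => m _;
  exact: rank0 (model_rankP m).
split; first exact: rank_submodular_semigraphoid A_ciP.
pose P : classical_sets.set 'rV[R]_n := rank_polytope (@model_rankP n) (submodels G).
exists P; split; [exact: polytope_sum| |by eexists].
have [V finV PE] : polytope P by apply: polytope_sum.
rewrite PE.
(* The coarse cones are the normal cones of the greedy vertices, and they cover the space because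
   every functional can be sorted. *)
apply: (@normal_fan_hull R n 'S_n V (greedy_vertex R f) (coarse_cone (dag_gaussoid G)));
  rewrite -?PE.
- exact: finV.
- by move=> s; apply: rank_polytope_greedy.
- by move=> s; apply: coarse_cone_greedy.
- move=> u; have [s su] := perm_cone_exists u; exists s.
  rewrite (coarse_cone_greedy R (@model_rankP n) A_wf A_ciP); split.
    exact: rank_polytope_greedy.
  by move=> y; apply: rank_polytope_greedy_max.
Qed.
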